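(* Let $f_1,f_2,\dots$ be independent random functions, each with distribution $\mathbb P_{\mathrm{poly}}$. Then almost surely the set $V=\{f_1,f_2,\dots\}$ is smoothly dense.
   Context: $C[0,1]$ is the space of continuous real functions on $[0,1]$ with the sup norm $\|\cdot\|$. The measure $\mathbb P_{\mathrm{poly}}$ on $C[0,1]$ is the law of the random polynomial $t\mapsto a_0+a_1t+\dots+a_nt^n$ (restricted to $[0,1]$), where $n$ is Poisson with mean $1$ and $a_0,a_1,\dots$ are i.i.d. standard normal, all independent. For $x\in\mathbb R$ let $\langle x\rangle=x-\lfloor x\rfloor$. For $f,g\in C[0,1]$, $\mathsf{cr}(f,g)=\{x\in[0,1]:\langle f(x)\rangle=\langle g(x)\rangle\}$. For finite $A,B\subseteq[0,1]$, $A\sim_\epsilon B$ means $|A|=|B|$ and, listing both in increasing order, the $i$-th elements are within $\epsilon$ for all $i$. A set $\mathcal F\subseteq C[0,1]$ is transverse if (i) the sets $\mathsf{cr}(f,g)$ are pairwise disjoint for distinct pairs of distinct elements of $\mathcal F$; and (ii) for all distinct $f,g\in\mathcal F$, $\mathsf{cr}(f,g)$ is finite, does not contain $0$ or $1$, and no $t\in\mathsf{cr}(f,g)$ is a local extremum of $f-g$. A countable $V\subseteq C[0,1]$ is smoothly dense if: (1) $V$ is dense in $C[0,1]$; (2) $V$ is transverse; (3) every element of $V$ is Lipschitz; (4) for every finite $\mathcal F\subseteq V$, every $f\in C[0,1]$ with $\mathcal F\cup\{f\}$ transverse and every $\epsilon>0$, there is $g\in V$ with $\|f-g\|<\epsilon$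 and $\mathsf{cr}(f,h)\sim_\epsilon\mathsf{cr}(g,h)$ for all $h\in\mathcal F$. *)

(* Defs.v *)
From HB Require Import structures.
From mathcomp Require Import all_boot all_order all_algebra finmap.
From mathcomp Require Import all_classical all_reals all_analysis.

Set Implicit Arguments.
Unset Strict Implicit.
Unset Printing Implicit Defensive.

Import Order.TTheory GRing.Theory Num.Theory.
Import numFieldNormedType.Exports.

Local Open Scope classical_set_scope.
Local Open Scope ring_scope.

Definition unit_itv (R : realType) : set R := `[0, 1]%classic.

Arguments unit_itv R : clear implicits.

Notation I01 R := (set_type (unit_itv R)).

Definition C01 (R : realType) := continuousType (I01 R) R.

HB.instance Definition _ (R : realType) :=
  Choice.copy (C01 R) (continuousType (I01 R) R).

Definition supnorm (R : realType) (h : I01 R -> R) : R :=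
  sup [set `|h t| | t in [set: I01 R]].

Section sup_metric.
Variable R : realType.
Implicit Types f g : C01 R.

Lemma I01_0_subproof : (0 : R) \in unit_itv R.
Proof. by rewrite inE /unit_itv/= in_itv/= lexx ler01. Qed.

Definition I01_0 : I01 R := exist _ 0 I01_0_subproof.

Lemma has_sup_normB f g :
  has_sup [set `|f t - g t| | t in [set: I01 R]].
Proof.
split; first by exists `|f I01_0 - g I01_0|, I01_0.
pose h t : R := `|f t - g t|.
have ch : continuous h.
  by move=> t; exact: (cvg_norm (cvgB (@cts_fun _ _ f t) (@cts_fun _ _ g t))).
have /(EVT_max ler01)[c _ hc] :
    {within unit_itv R, continuous (valL_ (0 : R) h)}.
  exact/subspace_valL_continuousP'.
exists (valL_ (0 : R) h c) => _ [t _ <-].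
have := hc _ (set_valP t).
by rewrite -[valL_ _ _ (set_val t)]/((sigL _ (valL_ _ h)) t) valLK.
Qed.

Let dist f g := supnorm (fun t => f t - g t).

Let le_dist f g t : `|f t - g t| <= dist f g.
Proof. by apply: (sup_upper_bound (has_sup_normB f g)); exists t. Qed.

Let dist_le f g e : (forall t, `|f t - g t| <= e) -> dist f g <= e.
Proof.
move=> H; apply: sup_le_ub; last by move=> _ [t _ <-].
by exists `|f I01_0 - g I01_0|, I01_0.
Qed.

Let dist_ge0 f g : 0 <= dist f g.
Proof. exact: le_trans (le_dist f g I01_0). Qed.

Let distxx f : dist f f = 0.
Proof.
apply/le_anti/andP; split => //.
by apply: dist_le => t; rewrite subrr normr0.
Qed.

Let dist_positivity f g : dist f g = 0 -> f = g.
Proof.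
move=> fg0; apply/continuousEP => t; apply/eqP.
by rewrite -subr_eq0 -normr_le0 -fg0; exact: le_dist.
Qed.

Let dist_sym f g : dist f g = dist g f.
Proof.
rewrite /dist /supnorm; congr (sup _).
by apply/seteqP; split=> _ [t _ <-]; exists t => //; rewrite distrC.
Qed.

Let dist_triangle g f h : dist f h <= dist f g + dist g h.
Proof.
apply: dist_le => t.
by rewrite (le_trans (ler_distD (g t) _ _))// lerD// le_dist.
Qed.

HB.instance Definition _ := @isMetric.Build R (C01 R)
  dist distxx dist_positivity dist_sym dist_triangle.

Lemma C01_mdistE f g : mdist f g = supnorm (fun t => f t - g t).
Proof. by []. Qed.

End sup_metric.

Section polynomial_functions.
Variables (R : realType) (p : {poly R}).

Definition polyfun (t : I01 R) : R := p.[set_val t].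

Lemma polyfun_continuous : continuous polyfun.
Proof.
move=> t; apply: (@continuous_comp _ _ _ set_val (horner p)).
  exact: initial_continuous.
exact: continuous_horner.
Qed.

HB.instance Definition _ :=
  @isContinuous.Build (I01 R) R polyfun polyfun_continuous.

Definition polyC01 : C01 R := polyfun.

End polynomial_functions.

HB.instance Definition _ (R : realType) := isPointed.Build (C01 R) (polyC01 0).

Definition borelC01 (R : realType) := g_sigma_algebraType (@open (C01 R)).

HB.instance Definition _ (R : realType) := Measurable.on (borelC01 R).

Section independence.
Context {d} {T : measurableType d} {R : realType} (P : probability T R).

(* Mutual independence of a family of families of events: the product rule
   over every finite subfamily. *)
Definition indep_systems {I : choiceType} (G : I -> set_system T) : Prop :=
  forall (J : {fset I}) (E : I -> set T),
    (forall i, i \in J -> G i (E i)) ->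
    P (\bigcap_(i in [set` J]) E i) = (\prod_(i <- J) P (E i))%E.

Definition indep_RVs {I : choiceType} {d'} {U : measurableType d'}
    (X : I -> {RV P >-> U}) : Prop :=
  indep_systems (fun i => g_sigma_algebra_preimage (X i)).

(* N and all the a k are jointly independent; None indexes N. *)
Definition indep_degree_coefs (N : {RV P >-> nat}) (a : nat -> {RV P >-> R}) :
    Prop :=
  indep_systems (fun o : option nat =>
    if o is Some k then g_sigma_algebra_preimage (a k)
    else g_sigma_algebra_preimage N).

Definition random_poly (N : {RV P >-> nat}) (a : nat -> {RV P >-> R}) (w : T) :
    borelC01 R :=
  polyC01 (\poly_(k < (N w).+1) a k w).

End independence.

(* mu is the law of t |-> a_0 + a_1 t + ... + a_N t^N, with N Poisson of mean 1
   and the a_k standard normal, all independent, defined on some probability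
   space (the law does not depend on which one).  The second argument of
   poisson_prob is a dummy. *)
Definition is_Ppoly (R : realType) (mu : set (borelC01 R) -> \bar R) : Prop :=
  exists (d : measure_display) (T : measurableType d) (P : probability T R)
    (N : {RV P >-> nat}) (a : nat -> {RV P >-> R}),
  [/\ forall A, measurable A -> distribution P N A = poisson_prob 1 0 A,
      forall k A, measurable A -> distribution P (a k) A = normal_prob 0 1 A,
      indep_degree_coefs N a &
      forall A, measurable A -> mu A = pushforward P (random_poly N a) A].

Section smoothly_dense.
Variable R : realType.
Implicit Types (f g h : C01 R) (V F : set (C01 R)).

Definition fracpart (x : R) : R := x - (Num.floor x)%:~R.

Definition cr f g : set R :=
  [set set_val t | t in [set t : I01 R | fracpart (f t) = fracpart (g t)]].

Definition sim_eps (eps : R) (A B : set R) : Prop :=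
  exists s t : seq R,
    [/\ sorted <%R s /\ A = [set` s],
        sorted <%R t /\ B = [set` t],
        size s = size t &
        forall i, (i < size s)%N -> `|s`_i - t`_i| < eps].

Definition local_extremum (k : I01 R -> R) (t : I01 R) : Prop :=
  (\forall u \near t, k u <= k t) \/ (\forall u \near t, k t <= k u).

(* "Distinct pairs" are unordered pairs, as cr is symmetric. *)
Definition transverse F : Prop :=
  (forall f g f' g', F f -> F g -> F f' -> F g' -> f <> g -> f' <> g' ->
     [set f; g] <> [set f'; g'] -> cr f g `&` cr f' g' = set0) /\
  (forall f g, F f -> F g -> f <> g ->
     [/\ finite_set (cr f g), ~ cr f g 0, ~ cr f g 1 &
         forall t : I01 R, cr f g (set_val t) ->
           ~ local_extremum (fun u => f u - g u) t]).

Definition lipschitzC01 f : Prop :=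
  exists L : R, forall s t : I01 R, `|f s - f t| <= L * `|set_val s - set_val t|.

(* sim_eps compares finite sets, whereas cr f f is all of [0, 1]: the last
   clause therefore skips h = f, which occurs only when f is in F. *)
Definition smoothly_dense V : Prop :=
  [/\ countable V,
      dense V,
      transverse V,
      forall f, V f -> lipschitzC01 f &
      forall F f (eps : R), F `<=` V -> finite_set F ->
        transverse (F `|` [set f]) -> 0 < eps ->
        exists g, [/\ V g, supnorm (fun t => f t - g t) < eps &
          forall h, F h -> h <> f -> sim_eps eps (cr f h) (cr g h)]].

End smoothly_dense.

(* Main.v *)
Require Import Defs.
From HB Require Import structures.
From mathcomp Require Import all_boot all_order all_algebra finmap.
From mathcomp Require Import all_classical all_reals all_analysis.
From mathcomp Require Import measurable_realfun ring lra polyrcf.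

Set Implicit Arguments.
Unset Strict Implicit.
Unset Printing Implicit Defensive.

Import Order.TTheory GRing.Theory Num.Theory.
Import numFieldNormedType.Exports.

Local Open Scope classical_set_scope.
Local Open Scope ring_scope.

(* Almost surely the f_i are polynomials, and some f_i is close, both uniformly
   and in Lipschitz seminorm, to any prescribed polynomial q: for rational q
   this has a positive probability bounded below independently of i, and the
   f_i are independent.  If f is transverse to finitely many polynomials h,
   there is a polynomial q uniformly close to f with the same crossings with
   each h, all of them simple; a function close to q in the above sense then
   has one crossing near each of them and no other.

   Transversality follows from a union bound.  Since a_0 has a bounded density
   and is independent of the other coefficients, P(|f_i(x) - Y| <= r) <= C r
   for all Y independent of f_i.  A crossing of f_i and f_j at a local extremum
   makes f_i - f_j - k of size O(1/M^2) at one of M + 2 points of the grid of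
   step 1/(M + 1), and a common crossing of two pairs makes two differences
   simultaneously O(1/M) there; both events have probability O(1/M). *)

(** * Weierstrass approximation on the unit interval *)

(** The function to be approximated is merely continuous: at a crossing with h the difference f - h
    changes sign but may be arbitrarily flat, so a plain uniform approximation could cross h many
    times nearby. The polynomial must be built with a prescribed simple root at each crossing.
    Uniform closeness would not keep such roots single under perturbation; control of difference
    quotients does, and unlike closeness of derivatives it can be tested by countably many
    evaluations, hence is a Borel condition. Each copy of the law comes with its own auxiliary
    probability space, so every estimate is stated for a Borel set of C[0, 1] before being used for
    the f_i. Differences of two pairs sharing a function are not independent. Yet of two different
    pairs one contains an index absent from the other, and that function still randomises its
    difference when all the others are frozen. *)

Section unit_segment.
Variable R : realType.
Implicit Types (f g : R -> R) (c d x y e : R) (p q : {poly R}).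

Lemma continuous_dist f x e : continuous f -> 0 < e ->
  exists2 d : R, 0 < d & forall y, `|y - x| < d -> `|f y - f x| < e.
Proof.
move=> cf e0; have /cvgrPdist_lt /(_ _ e0) := cf x.
move=> /nbhs_ballP [d /= d0 xd]; exists d => // y yx.
by rewrite distrC; apply: xd; rewrite /ball /= distrC.
Qed.

(** Compactness packaged once: [c] can stand for any small quantity, such as a radius, a gap or the
    inverse of a bound, so that uniform continuity, boundedness and distance to the integers all
    become instances. *)
Lemma unit_segment_uniform (P : R -> R -> Prop) :
  (forall x, 0 <= x <= 1 -> exists2 d : R, 0 < d &
     forall c y, 0 < c < d -> `|y - x| < d -> 0 <= y <= 1 -> P c y) ->
  exists2 d : R, 0 < d & forall c y, 0 < c < d -> 0 <= y <= 1 -> P c y.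
Proof.
move=> loc; have /compact_near_coveringP cpt := @segment_compact R 0 1.
have : \forall c \near 0^'+, `[0, 1]%classic `<=` (fun y => 0 <= y <= 1 -> P c y).
  apply: cpt => x /=; rewrite in_itv /= => /loc[d d0 Hd].
  exists (ball x d, [set c | 0 < c < d]) => /=.
    split; first exact: nbhsx_ballx.
    by near=> c => /=; apply/andP; split; near: c; [exact: nbhs_right_gt|exact: nbhs_right_lt].
  by move=> [y c] /= [yx cd] y01; apply: (Hd c y) => //; rewrite distrC.
move=> [d /= d0 Hd]; exists d => // c y /andP[c0 cd] y01.
by apply: (Hd c) => //=; rewrite ?in_itv ?sub0r ?normrN ?gtr0_norm.
Unshelve. all: by end_near. Qed.

Lemma unit_segment_unif_cont f e : continuous f -> 0 < e ->
  exists2 d : R, 0 < d & forall x y, 0 <= x <= 1 -> 0 <= y <= 1 ->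
    `|y - x| < d -> `|f y - f x| < e.
Proof.
move=> cf e0.
have [|d d0 Hd] := @unit_segment_uniform (fun c x => forall y,
    `|y - x| < c -> `|f y - f x| < e).
  move=> x x01; have [d d0 Hd] := continuous_dist x cf (divr_gt0 e0 (ltr0n _ 2)).
  exists (d / 2); first by rewrite divr_gt0.
  move=> c y /andP[c0 cd] yx y01 z zy.
  have := Hd y; have := Hd z; move: zy yx; rewrite !ltr_norml => /andP[? ?] /andP[? ?].
  by move=> /(_ ltac:(apply/andP; split; lra)) /andP[? ?]
    /(_ ltac:(apply/andP; split; lra)) /andP[? ?]; apply/andP; split; lra.
exists (d / 2) => [|x y x01 y01 yx]; first by rewrite divr_gt0.
by apply: (Hd (d / 2)) => //; apply/andP; split; lra.
Qed.

Lemma unit_segment_bounded f : continuous f ->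
  exists2 B : R, 0 < B & forall x, 0 <= x <= 1 -> `|f x| <= B.
Proof.
move=> cf; have [|d d0 Hd] := @unit_segment_uniform (fun c x => `|f x| <= c^-1).
  move=> x x01; have [d d0 Hd] := continuous_dist x cf ltr01.
  exists (Num.min d (`|f x| + 1)^-1); first by rewrite lt_min d0 invr_gt0 ltr_wpDl.
  move=> c y /andP[c0]; rewrite !lt_min => /andP[cd cf1] /andP[yd _] _.
  have : `|f x| + 1 < c^-1.
    by rewrite -[ltLHS]invrK ltf_pV2 // posrE ?invr_gt0 ltr_wpDl.
  have := Hd y yd; have := ler_normD (f y - f x) (f x); rewrite subrK; lra.
exists (d / 2)^-1 => [|x x01]; first by rewrite invr_gt0 divr_gt0.
by apply: Hd => //; apply/andP; split; lra.
Qed.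

(* [bernstein n u] is \sum_(k <= n) u_k 'C(n, k) X^k (1 - X)^(n - k), defined
   through the Pascal recursion so that its moments follow by induction. *)
Fixpoint bernstein n (u : nat -> R) : {poly R} :=
  if n is m.+1 then 'X * bernstein m (fun k => u k.+1) + (1 - 'X) * bernstein m u
  else (u 0%N)%:P.

Lemma bernstein_le n (u v : nat -> R) x : 0 <= x <= 1 ->
  (forall k, (k <= n)%N -> u k <= v k) -> (bernstein n u).[x] <= (bernstein n v).[x].
Proof.
move=> /andP[x0 x1]; elim: n u v => [|n IH] u v uv /=; first by rewrite !hornerE uv.
rewrite !hornerE; apply: lerD; apply: ler_wpM2l => //; rewrite ?subr_ge0 //.
  by apply: IH => k kn; apply: uv.
by apply: IH => k kn; apply/uv/leqW.
Qed.

(** The bracket is the second moment about [c] of a binomial variable with parameters [n] and [x]: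
    its variance plus the squared bias. *)
Lemma bernstein_square n (a b c : R) x :
  (bernstein n (fun k => a + b * (k%:R - c) ^+ 2)).[x] =
  a + b * (n%:R * x * (1 - x) + (n%:R * x - c) ^+ 2).
Proof.
elim: n c => [|n IH] c /=; first by rewrite !hornerE; ring.
rewrite !hornerE IH; under [fun k => _]funext => k.
  rewrite -natr1 (_ : k%:R + 1 - c = k%:R - (c - 1)); last by ring.
  over.
by rewrite IH -natr1; ring.
Qed.

(** Bernstein's proof: f lies between the two parabolas [f x ± (e / 2 + D * (y - x) ^ 2)] in y, the
    operator is monotone, and on parabolas it is explicit, leaving at x an excess of
    [D * x * (1 - x) / n]. *)
Lemma weierstrass f e : continuous f -> 0 < e ->
  exists p, forall x, 0 <= x <= 1 -> `|p.[x] - f x| < e.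
Proof.
move=> cf e0.
have [d d0 Hd] := unit_segment_unif_cont cf (divr_gt0 e0 (ltr0n _ 2)).
have [B B0 HB] := unit_segment_bounded cf.
(* Where [|y - x| >= d] the quadratic term must dominate the largest possible oscillation
   [2 * B]. *)
pose D := 2 * B / d ^+ 2.
have D0 : 0 < D by rewrite divr_gt0 ?mulr_gt0 ?exprn_gt0.
have fD x y : 0 <= x <= 1 -> 0 <= y <= 1 ->
    `|f y - f x| <= e / 2 + D * (y - x) ^+ 2.
  move=> x01 y01; have [yx|yx] := ltP `|y - x| d.
    apply: ltW; apply: (lt_le_trans (Hd _ _ x01 y01 yx)).
    by rewrite lerDl mulr_ge0 ?sqr_ge0 // ltW.
  have : d ^+ 2 <= (y - x) ^+ 2 by rewrite -(real_normK (num_real (y - x))) lerXn2r // ?nnegrE // ltW.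
  move=> /(ler_wpM2l (ltW D0)); rewrite /D divfK ?gt_eqF ?exprn_gt0 //.
  have := ler_normB (f y) (f x); have := HB _ x01; have := HB _ y01; lra.
pose n := (Num.truncn (D / e)).+1.
have n0 : 0 < n%:R :> R by rewrite ltr0n.
have nD : D / n%:R < e.
  by rewrite ltr_pdivrMr // mulrC -ltr_pdivrMr // truncnS_gt.
have kn k : (k <= n)%N -> 0 <= (k%:R / n%:R : R) <= 1.
  by move=> kn; rewrite divr_ge0 //= ler_pdivrMr // mul1r ler_nat.
have sq k x : D * (k%:R / n%:R - x) ^+ 2 =
    (D / n%:R ^+ 2) * (k%:R - n%:R * x) ^+ 2.
  by field; rewrite gt_eqF.
have bnd x : 0 <= x <= 1 ->
    D / n%:R ^+ 2 * (n%:R * x * (1 - x) + (n%:R * x - n%:R * x) ^+ 2) < e / 2.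
  move=> /andP[x0 x1]; rewrite subrr expr0n /= addr0.
  have -> : D / n%:R ^+ 2 * (n%:R * x * (1 - x)) = D / n%:R * (x * (1 - x)).
    by field; rewrite gt_eqF.
  have : x * (1 - x) <= 1 / 2 by nra.
  move=> /(ler_wpM2l (ltW (divr_gt0 D0 n0))); lra.
exists (bernstein n (fun k => f (k%:R / n%:R))) => x x01.
have x01' := bnd _ x01.
have ub : (bernstein n (fun k => f (k%:R / n%:R))).[x] <=
   (f x + e / 2) + D / n%:R ^+ 2 * (n%:R * x * (1 - x) + (n%:R * x - n%:R * x) ^+ 2).
  rewrite -bernstein_square; apply: bernstein_le => // k /kn k01.
  by rewrite -sq; have := fD _ _ x01 k01; rewrite ler_norml; lra.
have lb : (f x - e / 2) + - (D / n%:R ^+ 2) * (n%:R * x * (1 - x) + (n%:R * x - n%:R * x) ^+ 2)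
    <= (bernstein n (fun k => f (k%:R / n%:R))).[x].
  rewrite -bernstein_square; apply: bernstein_le => // k /kn k01.
  by rewrite mulNr -sq; have := fD _ _ x01 k01; rewrite ler_norml; lra.
by rewrite ltr_norml; apply/andP; split; lra.
Qed.

End unit_segment.

(** * Approximation with simple crossings *)

(** Finite counterpart of [unit_segment_uniform]: since each threshold admits every smaller [c], the
    least threshold serves the whole list. *)
Lemma seq_uniform (R : realType) (A : eqType) (s : seq A) (P : A -> R -> Prop) :
  (forall t, t \in s -> exists2 d : R, 0 < d & forall c : R, 0 < c <= d -> P t c) ->
  exists2 d : R, 0 < d & forall t (c : R), t \in s -> 0 < c <= d -> P t c.
Proof.
elim: s => [|a s IH] H; first by exists 1.
have [d d0 Hd] := IH (fun t ts => H t (@mem_behead _ (a :: s) _ ts)).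
have [e e0 He] := H a (mem_head _ _).
exists (Num.min d e) => [|t c]; first by rewrite lt_min d0.
rewrite inE le_min => /orP[/eqP->|ts] /and3P[c0 cd ce].
  by apply: He; rewrite c0.
by apply: Hd => //; rewrite c0.
Qed.

Section interpolation.
Variable R : realType.
Implicit Types (s : seq R) (c d x y t e eta : R) (p q : {poly R}).

Lemma prod_XsubC_neq0 s t : t \notin s -> (\prod_(x <- s) ('X - x%:P)).[t] != 0.
Proof. by rewrite -root_prod_XsubC. Qed.

Lemma interpolation s (v : R -> R) : uniq s ->
  exists p, {in s, forall t, p.[t] = v t}.
Proof.
elim: s => [|a s IH] /=; first by exists 0.
move=> /andP[nas /IH[p Hp]]; pose w := \prod_(x <- s) ('X - x%:P).
have wa := prod_XsubC_neq0 nas.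
exists (p + ((v a - p.[a]) / w.[a])%:P * w) => t.
rewrite inE !hornerE => /orP[/eqP->|ts]; first by rewrite divfK // subrKC.
have /eqP -> : w.[t] == 0 by rewrite -rootE root_prod_XsubC.
by rewrite mulr0 addr0 Hp.
Qed.

Lemma root_dvdXsubC p t : p.[t] = 0 -> exists r, p = ('X - t%:P) * r.
Proof. by move/eqP/factor_theorem => [r ->]; exists r; rewrite mulrC. Qed.

(* Write [u] for an interpolant of [f] at [s] and [w] for the product of the
   [X - t].  The approximant is [u + w v] with [v] a polynomial close to
   [((f - u) w + rho z) / (w ^ 2 + rho)]: the regularisation [rho] removes the
   singularity of [(f - u) / w], and [z] is chosen so that the correction term
   [rho z] has the right sign near each [t]. *)
Lemma simple_crossing_approx (f : R -> R) s (b : R -> {poly R}) (sg : R -> R) eta :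
  continuous f -> uniq s -> 0 < eta ->
  {in s, forall t, (b t).[t] = f t} ->
  {in s, forall t, sg t ^+ 2 = 1} ->
  {in s, forall t x, `|x - t| < eta -> 0 <= sg t * ((x - t) * (f x - (b t).[x]))} ->
  exists2 eta' : R, 0 < eta' <= eta & forall e, 0 < e -> exists2 q,
    forall x, 0 <= x <= 1 -> `|q.[x] - f x| < e &
    {in s, forall t, exists2 r, q - b t = ('X - t%:P) * r &
      forall x, 0 <= x <= 1 -> `|x - t| < eta' -> 0 < sg t * r.[x]}.
Proof.
move=> cf us eta0 bf sg1 sgf.
have [u uf] := interpolation f us.
have /choice[d_ dE] t : exists r, t \in s -> u - b t = ('X - t%:P) * r.
  have [ts|_] := boolP (t \in s); last by exists 0.
  have [|r ->] := @root_dvdXsubC (u - b t) t; last by exists r.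
  by rewrite hornerD hornerN uf // bf // subrr.
pose w := \prod_(x <- s) ('X - x%:P); pose w_ t := \prod_(x <- rem t s) ('X - x%:P).
have wE t : t \in s -> w = ('X - t%:P) * w_ t by move=> ts; rewrite /w (big_rem t).
have w_n0 t : (w_ t).[t] != 0.
  apply: prod_XsubC_neq0; rewrite (rem_filter _ us) mem_filter /=.
  by rewrite eqxx.
(* At [t] the polynomial [d_ t + w_ t * z] takes the value [sg t]; by continuity it keeps this sign,
   with modulus above 1/2, around [t]. *)
have [z zE] := interpolation (fun t => (sg t - (d_ t).[t]) / (w_ t).[t]) us.
have [eta1 eta10 Heta1] : exists2 d : R, 0 < d & forall t c, t \in s -> 0 < c <= d ->
    forall x, `|x - t| < c -> 1 / 2 < sg t * (d_ t + w_ t * z).[x].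
  apply: seq_uniform => t ts.
  have [||d d0 Hd] := @continuous_dist R (horner (d_ t + w_ t * z)) t (1 / 2).
  - exact: continuous_horner.
  - by rewrite divr_gt0.
  exists d => // c /andP[c0 cd] x xc.
  have := Hd x (lt_le_trans xc cd).
  have -> : (d_ t + w_ t * z).[t] = sg t.
    by rewrite !hornerE zE // mulrCA divff // mulr1 subrKC.
  have /eqP := sg1 _ ts; rewrite sqrf_eq1 => /orP[]/eqP->; rewrite ltr_norml => /andP[]; lra.
exists (Num.min eta eta1); first by rewrite lt_min eta0 eta10 ge_min lexx.
move=> e e0.
have cu : continuous (horner u) by exact: continuous_horner.
have cz : continuous (horner z) by exact: continuous_horner.
have cw : continuous (horner w) by exact: continuous_horner.
(* With [v1] below in place of [v], the error of the approximant is [rho * phi / (w ^ 2 + rho)]. It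
   tends to 0 with [rho] uniformly: near [s] because [phi] vanishes on [s], elsewhere because
   [w ^ 2] is bounded below. *)
pose phi x := w.[x] * z.[x] - (f x - u.[x]).
have cphi : continuous phi.
  move=> x; apply: cvgB; first by apply: cvgM; [exact: cw|exact: cz].
  by apply: cvgB; [exact: cf|exact: cu].
have [rho0 rho00 Hrho] : exists2 d : R, 0 < d & forall c y, 0 < c < d -> 0 <= y <= 1 ->
    c * `|phi y| <= e / 2 * (w.[y] ^+ 2 + c).
  apply: unit_segment_uniform => x x01.
  have e2 : 0 < e / 2 by rewrite divr_gt0.
  have [wx0|wx0] := eqVneq w.[x] 0.
    have phix : phi x = 0.
      rewrite /phi wx0 mul0r uf ?subrr //.
      by rewrite -root_prod_XsubC; apply/eqP.
    have [d d0 Hd] := continuous_dist x cphi e2.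
    exists d => // c y /andP[c0 _] /Hd; rewrite phix subr0 => phiy _.
    rewrite mulrDr [_ * c]mulrC; apply: ler_wpDl.
      by rewrite mulr_ge0 ?sqr_ge0 // ltW.
    by rewrite ler_pM2l // ltW.
  have w20 : 0 < `|w.[x]| by rewrite normr_gt0.
  have [d1 d10 Hd1] := continuous_dist x cw (divr_gt0 w20 (ltr0n _ 2)).
  have [d2 d20 Hd2] := continuous_dist x cphi ltr01.
  pose d3 := e / 2 * (`|w.[x]| / 2) ^+ 2 / (`|phi x| + 1).
  have phi1 : 0 < `|phi x| + 1 by rewrite ltr_wpDl.
  have d30 : 0 < d3 by rewrite divr_gt0 // mulr_gt0 // exprn_gt0 // divr_gt0.
  exists (Num.min d1 (Num.min d2 d3)); first by rewrite !lt_min d10 d20.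
  move=> c y; rewrite !lt_min => /and4P[c0 _ _ cd3] /and3P[/Hd1 yd1 /Hd2 yd2 _] _.
  have : c * (`|phi x| + 1) <= e / 2 * (`|w.[x]| / 2) ^+ 2.
    by rewrite -ler_pdivlMr // ltW.
  have : `|phi y| <= `|phi x| + 1.
    by have := ler_normD (phi y - phi x) (phi x); rewrite subrK; lra.
  move=> /(ler_wpM2l (ltW c0)) h1 h2; apply: (le_trans h1); apply: (le_trans h2).
  apply: ler_wpM2l; first exact: ltW.
  apply: ler_wpDr; first exact: ltW.
  rewrite -[leRHS](real_normK (num_real _)); apply: lerXn2r; rewrite ?nnegrE ?divr_ge0 //.
  by have := ler_normD (w.[x] - w.[y]) w.[y]; rewrite subrK distrC; lra.
have {rho0 rho00 Hrho}[rho rhogt0 Hrho] : exists2 rho : R, 0 < rho &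
    forall x, 0 <= x <= 1 -> rho * `|phi x| <= e / 2 * (w.[x] ^+ 2 + rho).
  exists (rho0 / 2) => [|x]; first by rewrite divr_gt0.
  by apply: Hrho; apply/andP; split; lra.
have den0 x : 0 < w.[x] ^+ 2 + rho by rewrite ltr_wpDl // sqr_ge0.
pose v1 x := ((f x - u.[x]) * w.[x] + rho * z.[x]) / (w.[x] ^+ 2 + rho).
have cv1 : continuous v1.
  move=> x; apply: cvgM.
    apply: cvgD; first by apply: cvgM; [apply: cvgB; [exact: cf|exact: cu]|exact: cw].
    by apply: cvgM; [exact: cvg_cst|exact: cz].
  apply: cvgV; first by rewrite gt_eqF.
  by apply: cvgD; [apply: cvgM; exact: cw|exact: cvg_cst].
have [W W0 HW] := unit_segment_bounded cw.
(* A lower bound for [sg t * (d_ t + w_ t * v1)] near [t]; the passage from [v1] to [v] must cost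
   less than this. *)
pose m := rho / 2 / (W ^+ 2 + rho).
have m0 : 0 < m by rewrite divr_gt0 ?divr_gt0 // ltr_wpDl // sqr_ge0.
have [k1 k10 Hk1] : exists2 d : R, 0 < d & forall t c, t \in s -> 0 < c <= d ->
    forall x, 0 <= x <= 1 -> c * `|(w_ t).[x]| < m.
  apply: seq_uniform => t ts.
  have [B B0 HB] := unit_segment_bounded (@continuous_horner R (w_ t)).
  exists (m / (B + 1)); first by rewrite divr_gt0 // addr_gt0.
  move=> c /andP[c0 cB] x x01; apply: (@le_lt_trans _ _ (m / (B + 1) * B)).
    by apply: ler_pM; rewrite ?HB // ltW.
  by rewrite -mulrA gtr_pMr // mulrC ltr_pdivrMr ?addr_gt0 // mul1r; lra.
pose k := Num.min k1 (e / 2 / (W + 1)).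
have k0 : 0 < k by rewrite lt_min k10 !divr_gt0 // addr_gt0.
have [v Hv] := weierstrass cv1 k0.
exists (u + w * v) => [x x01|t ts].
  have -> : (u + w * v).[x] - f x =
      w.[x] * (v.[x] - v1 x) + rho * phi x / (w.[x] ^+ 2 + rho).
    by rewrite !hornerE /v1 /phi; field; rewrite gt_eqF.
  apply: (le_lt_trans (ler_normD _ _)).
  rewrite (splitr e); apply: ltr_leD; last first.
    by rewrite !normrM normfV (gtr0_norm rhogt0) (gtr0_norm (den0 x)) ler_pdivrMr // Hrho.
  rewrite normrM; apply: (@le_lt_trans _ _ (W * k)).
    by apply: ler_pM; rewrite ?HW // ltW // Hv.
  apply: (@le_lt_trans _ _ (W * (e / 2 / (W + 1)))).
    by apply: ler_wpM2l; [exact: ltW|rewrite ge_min lexx orbT].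
  by rewrite mulrCA -[ltRHS]mulr1 ltr_pM2l ?divr_gt0 // ltr_pdivrMr ?addr_gt0 // mul1r; lra.
exists (d_ t + w_ t * v); first by rewrite mulrDr mulrA -dE // -wE //; ring.
move=> x x01; rewrite lt_min => /andP[/(sgf _ ts) sgx xt1].
have {xt1} := Heta1 t eta1 ts _ x xt1; rewrite eta10 lexx => /(_ isT) Hz.
(* Over the denominator [w ^ 2 + rho] the quantity splits into [w_ t ^ 2] times a term that is
   nonnegative by the sign hypothesis on [f - b t], and [rho] times the term that [z] keeps above
   1/2. *)
have key : m <= sg t * ((d_ t).[x] + (w_ t).[x] * v1 x).
  have fE : f x - (b t).[x] = f x - u.[x] + (x - t) * (d_ t).[x].
    have /(congr1 (horner^~ x)) := dE _ ts; rewrite !hornerE; lra.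
  have wxE : w.[x] = (x - t) * (w_ t).[x] by rewrite (wE _ ts) !hornerE.
  have -> : sg t * ((d_ t).[x] + (w_ t).[x] * v1 x) =
    ((w_ t).[x] ^+ 2 * (sg t * ((x - t) * (f x - (b t).[x]))) +
     rho * (sg t * (d_ t + w_ t * z).[x])) / (w.[x] ^+ 2 + rho).
    rewrite fE hornerD hornerM /v1; have := den0 x; rewrite wxE => dn0.
    by field; rewrite gt_eqF.
  rewrite ler_pdivlMr // /m; apply: (@le_trans _ _ (rho / 2)).
    rewrite mulrAC ler_pdivrMr; last by rewrite ltr_wpDl // sqr_ge0.
    rewrite ler_pM2l ?divr_gt0 //.
    rewrite lerD2r -(real_normK (num_real w.[x])); apply: lerXn2r; rewrite ?nnegrE ?HW //.
    exact: ltW.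
  apply: ler_wpDl; first by rewrite mulr_ge0 // sqr_ge0.
  by rewrite ler_pM2l // ltW //; move: Hz; rewrite div1r.
have : `|sg t * ((w_ t).[x] * (v.[x] - v1 x))| < m.
  rewrite normrM; have -> : `|sg t| = 1.
    by have /eqP := sg1 _ ts; rewrite sqrf_eq1 => /orP[]/eqP->; rewrite ?normrN normr1.
  rewrite mul1r normrM mulrC.
  apply: (@le_lt_trans _ _ (k * `|(w_ t).[x]|)); first by apply: ler_wpM2r => //; rewrite ltW // Hv.
  by apply: (Hk1 t) => //; rewrite k0 ge_min lexx.
rewrite ltr_norml hornerD hornerM => /andP[]; lra.
Qed.

End interpolation.

(** * Stability of simple crossings under small Lipschitz perturbations *)

Section crossing_stability.
Variable R : realType.
Implicit Types (s : seq R) (c d x y t e eta : R) (p q : {poly R}).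

Definition isint y := exists k : int, y = k%:~R.

Lemma int_dist_lt1 (k l : int) : `|k%:~R - l%:~R : R| < 1 -> k = l.
Proof.
rewrite -intrB -intr_norm -[1]/(1%:~R) ltr_int => kl.
by apply/eqP; rewrite -subr_eq0 -normr_le0 -ltzD1.
Qed.

Lemma nonint_gap y : ~ isint y -> exists2 c : R, 0 < c &
  forall z, `|z - y| < c -> forall k : int, c <= `|z - k%:~R|.
Proof.
move=> ny; have /andP[m1 m2] := floor_itv y; set m := Num.floor y in m1 m2.
have {}m1 : m%:~R < y.
  by rewrite lt_neqAle m1 andbT; apply/eqP => E; apply: ny; exists m.
rewrite intrD in m2.
exists (Num.min ((y - m%:~R) / 2) ((m%:~R + 1 - y) / 2)).
  by rewrite lt_min !divr_gt0 //; lra.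
move=> z; rewrite lt_min => /andP[]; rewrite !ltr_norml => /andP[z1 z2] /andP[z3 z4] k.
rewrite ge_min; have [km|km] := leP k m.
  have {}km : k%:~R <= m%:~R :> R by rewrite ler_int.
  apply/orP; left; apply: (@le_trans _ _ (z - k%:~R)); last exact: ler_norm.
  lra.
have {}km : m%:~R + 1 <= k%:~R :> R by rewrite -[1]/(1%:~R) -intrD ler_int lezD1.
apply/orP; right; rewrite distrC; apply: (@le_trans _ _ (k%:~R - z)); last exact: ler_norm.
lra.
Qed.

(** Near a point of [s] the claim is vacuous at radius [eta]; near any other point f is not an
    integer and keeps a gap by continuity. Compactness makes the gap uniform. *)
Lemma segment_int_gap (f : R -> R) s eta : continuous f -> 0 < eta ->
  (forall x, 0 <= x <= 1 -> isint (f x) -> x \in s) ->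
  exists2 c : R, 0 < c & forall x, 0 <= x <= 1 ->
    {in s, forall t, eta <= `|x - t|} -> forall k : int, c <= `|f x - k%:~R|.
Proof.
move=> cf eta0 fs.
have [|d d0 Hd] := @unit_segment_uniform R (fun c x =>
    {in s, forall t, eta <= `|x - t|} -> forall k : int, c <= `|f x - k%:~R|).
  move=> x x01; have [xs|xs] := boolP (x \in s).
    by exists eta => // c y _ xy _ /(_ _ xs); rewrite leNgt xy.
  have /nonint_gap[c0 c00 Hc0] : ~ isint (f x) by move=> /(fs _ x01); apply/negP.
  have [d d0 Hd] := continuous_dist x cf c00.
  exists (Num.min d c0); first by rewrite lt_min d0.
  move=> c y; rewrite !lt_min => /and3P[_ _ cc0] /andP[/Hd yx _] _ _ k.
  by apply: le_trans (Hc0 _ yx k); exact: ltW.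
exists (d / 2); first by rewrite divr_gt0.
by move=> x x01 xs k; apply: Hd => //; apply/andP; split; lra.
Qed.

Lemma poly_slope p (sg a t eta : R) :
  (forall x, `|x - t| <= eta -> a <= sg * p^`().[x]) ->
  forall x y, `|x - t| <= eta -> `|y - t| <= eta -> x < y ->
    a * (y - x) <= sg * (p.[y] - p.[x]).
Proof.
move=> Ha x y xt yt xy; have [z zxy ->] := poly_mvt p xy.
rewrite mulrA ler_wpM2r ?subr_ge0 ?(ltW xy) //; apply: Ha.
move: zxy xt yt; rewrite in_itv /= !ler_norml => /andP[? ?] /andP[? ?] /andP[? ?].
by apply/andP; split; lra.
Qed.

(** Around each [t] in [s] the slope of [p] has a fixed sign and modulus at least [a], so a
    perturbation with Lipschitz constant [a / 2] stays strictly monotone there and meets the level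
    [p.[t]] exactly once. Elsewhere the gap to the integers excludes crossings. *)
Lemma crossing_stability p s e : 0 < e -> sorted <%R s ->
  {in s, forall t, 0 < t < 1} ->
  (forall x, 0 <= x <= 1 -> isint p.[x] <-> x \in s) ->
  {in s, forall t, p^`().[t] != 0} ->
  exists2 d : R, 0 < d & forall g : R -> R, continuous g ->
    (forall x, 0 <= x <= 1 -> `|g x - p.[x]| <= d) ->
    (forall x y, 0 <= x <= 1 -> 0 <= y <= 1 ->
       `|(g x - p.[x]) - (g y - p.[y])| <= d * `|x - y|) ->
    exists s' : seq R, [/\ sorted <%R s',
      forall x, x \in s' <-> 0 <= x <= 1 /\ isint (g x),
      size s = size s' & forall i, (i < size s)%N -> `|s`_i - s'`_i| < e].
Proof.
move=> e0 ss s01 ps p'n0.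
have [a a0 Ha] : exists2 a : R, 0 < a & forall t c, t \in s -> 0 < c <= a ->
    c <= `|p^`().[t]| / 2.
  apply: seq_uniform => t /p'n0 pt0; exists (`|p^`().[t]| / 2).
    by rewrite divr_gt0 ?normr_gt0.
  by move=> c /andP[].
have {}Ha t : t \in s -> a <= `|p^`().[t]| / 2 by move=> ts; apply: Ha; rewrite ?a0 /=.
have sgp' t : t \in s -> Num.sg p^`().[t] = 1 /\ `|p^`().[t]| = p^`().[t] \/
    Num.sg p^`().[t] = -1 /\ `|p^`().[t]| = - p^`().[t].
  move=> /p'n0; case: (ltrgtP 0 p^`().[t]) => [p0|p0|<-]; rewrite ?eqxx // => _; [left|right].
    by rewrite gtr0_sg // gtr0_norm.
  by rewrite ltr0_sg // ltr0_norm.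
(* Mutual distances above [2 * c] keep the displaced crossings in the same order; the oscillation
   bound 1/4 leaves room for a single integer level. *)
pose good t c := [/\ c < e, c <= t, t + c <= 1,
  forall t', t' \in s -> t' != t -> 2 * c < `|t' - t| &
  forall x, `|x - t| <= c -> `|p.[x] - p.[t]| < 1 / 4 /\
     a <= Num.sg p^`().[t] * p^`().[x]].
have [eta eta0 Heta] : exists2 d : R, 0 < d & forall t c, t \in s -> 0 < c <= d ->
    good t c.
  apply: seq_uniform => t ts; have /andP[t0 t1] := s01 _ ts.
  have [d1 d10 Hd1] : exists2 d : R, 0 < d & forall t' c, t' \in s -> 0 < c <= d ->
      t' != t -> 2 * c < `|t' - t|.
    apply: seq_uniform => t' t's; have [->|t't] := eqVneq t' t; first by exists 1.
    exists (`|t' - t| / 3); first by rewrite divr_gt0 // normr_gt0 subr_eq0.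
    move=> c /andP[c0 cd] _; have : 0 < `|t' - t| by rewrite normr_gt0 subr_eq0.
    lra.
  have [d2 d20 Hd2] := continuous_dist t (@continuous_horner R p)
    (divr_gt0 ltr01 (ltr0n _ 4)).
  have [d3 d30 Hd3] := continuous_dist t (@continuous_horner R p^`()) a0.
  exists (Num.min (e / 2) (Num.min t (Num.min (1 - t) (Num.min d1 (Num.min (d2 / 2) (d3 / 2)))))).
    by rewrite !lt_min d10 t0 subr_gt0 t1 !divr_gt0.
  move=> c; rewrite !le_min => /and5P[c0 c1 c2 c3 /and3P[c4 c5 c6]].
  split; [lra|by []|lra| |].
    by move=> t' t's t't; apply: Hd1 => //; rewrite c0.
  move=> x xt; split; first by apply: Hd2; lra.
  have := Hd3 x ltac:(lra); have := Ha _ ts.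
  have [[-> ->]|[-> ->]] := sgp' _ ts; rewrite ltr_norml => ? /andP[]; lra.
have [|c0 c00 Hc0] := @segment_int_gap (horner p) s eta (@continuous_horner R p) eta0.
  by move=> x x01 /ps -/(_ x01).
(* In order: half of the slope survives; g passes the level [p.[t]] between [t - eta] and [t + eta];
   no crossing appears away from [s]; near [t] no integer other than [p.[t]] is reached. *)
pose d := Num.min (a / 2) (Num.min (a * eta / 2) (Num.min (c0 / 2) (1 / 4))).
have d0 : 0 < d by rewrite !lt_min !divr_gt0 // mulr_gt0.
have [da [deta [dc0 d4]]] : d <= a / 2 /\ d <= a * eta / 2 /\ d <= c0 / 2 /\ d <= 1 / 4.
  by have := lexx d; rewrite {2}/d !le_min => /and4P[? ? ? ?]; do !split.
clearbody d; exists d => // g cg gp gL.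
have in01 t x : t \in s -> `|x - t| <= eta -> 0 <= x <= 1.
  move=> ts; have [_ ? ? _ _] := Heta t eta ts ltac:(by rewrite eta0 /=).
  by rewrite ler_norml => /andP[? ?]; apply/andP; split; lra.
have slope t x y : t \in s -> `|x - t| <= eta -> `|y - t| <= eta -> x < y ->
    a / 2 * (y - x) <= Num.sg p^`().[t] * (g y - g x).
  move=> ts xt yt xy; have [_ _ _ _ Hg] := Heta t eta ts ltac:(by rewrite eta0 /=).
  have := @poly_slope p (Num.sg p^`().[t]) a t eta (fun x xt => (Hg x xt).2) x y xt yt xy.
  have := gL y x (in01 _ _ ts yt) (in01 _ _ ts xt).
  have : d * `|y - x| <= a / 2 * (y - x).
    by rewrite gtr0_norm ?subr_gt0 // ler_wpM2r // subr_ge0 ltW.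
  have [[-> _]|[-> _]] := sgp' _ ts; move=> ?; rewrite ler_norml => /andP[]; lra.
have /choice[tau tauE] t : exists u, t \in s -> `|u - t| <= eta /\ g u = p.[t].
  have [ts|_] := boolP (t \in s); last by exists 0.
  have [_ _ _ _ Hg] := Heta t eta ts ltac:(by rewrite eta0 /=).
  have te1 : `|t - eta - t| <= eta by rewrite addrAC subrr sub0r normrN gtr0_norm.
  have te2 : `|t + eta - t| <= eta by rewrite addrAC subrr add0r gtr0_norm.
  have te3 : `|t - t| <= eta by rewrite subrr normr0 ltW.
  have sl := @poly_slope p (Num.sg p^`().[t]) a t eta (fun x xt => (Hg x xt).2).
  have := sl _ _ te1 te3 ltac:(lra); have := sl _ _ te3 te2 ltac:(lra).
  have := gp _ (in01 _ _ ts te1); have := gp _ (in01 _ _ ts te2).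
  move=> g1 g2 s1 s2.
  have [|||u uI] := @IVT R (fun x => Num.sg p^`().[t] * g x) (t - eta) (t + eta)
      (Num.sg p^`().[t] * p.[t]).
  - lra.
  - apply: continuous_subspaceT => x; apply: cvgM; [exact: cvg_cst|exact: cg].
  - have [H1 H2] : Num.sg p^`().[t] * g (t - eta) <= Num.sg p^`().[t] * p.[t] /\
        Num.sg p^`().[t] * p.[t] <= Num.sg p^`().[t] * g (t + eta).
      move: g1 g2 s1 s2; rewrite !ler_norml.
      by have [[-> _]|[-> _]] := sgp' _ ts; move=> /andP[? ?] /andP[? ?] ? ?; split; lra.
    by rewrite ge_min H1 /= le_max H2 orbT.
  move=> E; exists u => _; split.
    by move: uI; rewrite in_itv /= ler_norml => /andP[? ?]; apply/andP; split; lra.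
  by apply: mulfI E; rewrite sgr_eq0 p'n0.
exists (map tau s); split.
- apply: (homo_sorted_in _ (allss s) ss).
  move=> t t' ts t's tt'; have [_ _ _ /(_ t' t's) + _] := Heta t eta ts ltac:(by rewrite eta0 /=).
  rewrite gt_eqF // gtr0_norm ?subr_gt0 // => /(_ isT) ?.
  have [+ _] := tauE _ ts; have [+ _] := tauE _ t's.
  rewrite !ler_norml => /andP[? ?] /andP[? ?]; lra.
- move=> x; split => [/mapP[t ts ->]|[x01 [k gk]]].
    have [h1 ->] := tauE _ ts; split; first exact: (in01 t).
    by apply/ps => //; have /andP[? ?] := s01 _ ts; apply/andP; split; exact: ltW.
  have [far|/existsNP[t /not_implyP[ts /negP]]] := pselect {in s, forall t, eta <= `|x - t|}.
    have := Hc0 x x01 far k; have := gp x x01; rewrite gk distrC; lra.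
  rewrite -ltNge => /ltW xt.
  have [_ _ _ _ /(_ x xt)[pxt _]] := Heta t eta ts ltac:(by rewrite eta0 /=).
  have [l pl] : isint p.[t].
    by apply/ps => //; have /andP[? ?] := s01 _ ts; apply/andP; split; exact: ltW.
  have kl : k = l.
    apply: int_dist_lt1; rewrite -gk -pl.
    by have := gp x x01; have := ler_distD p.[x] (g x) p.[t]; lra.
  have [tt gt] := tauE _ ts; have : g x = g (tau t) by rewrite gt pl gk kl.
  move=> gxt; apply/mapP; exists t => //.
  have a2 : 0 < a / 2 by rewrite divr_gt0.
  have [xl|xl|//] := ltrgtP x (tau t).
    have := slope t _ _ ts xt tt xl; rewrite gxt subrr mulr0.
    by rewrite pmulr_rle0 // subr_le0 leNgt xl.
  have := slope t _ _ ts tt xt xl; rewrite gxt subrr mulr0.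
  by rewrite pmulr_rle0 // subr_le0 leNgt xl.
- by rewrite size_map.
- move=> i si; rewrite (nth_map 0) // distrC; have ts := mem_nth 0 si.
  have [h1 _] := tauE _ ts; apply: (le_lt_trans h1).
  by have [] := Heta _ eta ts ltac:(by rewrite eta0 /=).
Qed.

End crossing_stability.

(** * Crossing sets through constant extensions to the real line *)

Section extension.
Variable R : realType.
Implicit Types (x y t : R) (f g : C01 R) (p : {poly R}).

Definition clamp x : R := Num.max 0 (Num.min 1 x).

Lemma clamp01 x : 0 <= clamp x <= 1.
Proof. by rewrite le_max lexx /= ge_max ler01 ge_min lexx. Qed.

Lemma clamp_id x : 0 <= x <= 1 -> clamp x = x.
Proof. by move=> /andP[x0 x1]; rewrite /clamp (min_idPr x1) (max_idPr x0). Qed.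

Lemma clamp_continuous : continuous clamp.
Proof.
move=> x; apply: (@continuous_max _ _ (cst 0) (fun x => Num.min 1 x)); first exact: cvg_cst.
by apply: (@continuous_min _ _ (cst 1) id); [exact: cvg_cst|exact: cvg_id].
Qed.

Lemma clamp_in x : clamp x \in unit_itv R.
Proof. by rewrite inE /unit_itv /= in_itv /= clamp01. Qed.

Definition clampI x : I01 R := exist _ (clamp x) (clamp_in x).

Lemma set_val01 (t : I01 R) : 0 <= set_val t <= 1.
Proof. by have := set_valP t; rewrite /unit_itv /= in_itv. Qed.

Lemma clampIK (t : I01 R) : clampI (set_val t) = t.
Proof. by apply: val_inj => /=; rewrite clamp_id // set_val01. Qed.

Lemma set_val_clampI x : 0 <= x <= 1 -> set_val (clampI x) = x.
Proof. exact: clamp_id. Qed.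

Lemma clampI_continuous : continuous clampI.
Proof. by apply: continuous_comp_initial; exact: clamp_continuous. Qed.

(** A total continuous function on the line, to which the intermediate value theorem and the
    approximation lemmas apply without points of a subtype. *)
Definition ext f x : R := f (clampI x).

Lemma ext_continuous f : continuous (ext f).
Proof.
move=> x; apply: (@continuous_comp _ _ _ clampI f); first exact: clampI_continuous.
exact: cts_fun.
Qed.

Lemma ext_val f (t : I01 R) : ext f (set_val t) = f t.
Proof. by rewrite /ext clampIK. Qed.

Lemma ext_poly p x : 0 <= x <= 1 -> ext (polyC01 p) x = p.[x].
Proof. by move=> x01; rewrite /ext /= /polyfun set_val_clampI. Qed.

Lemma fracpart_eq x y : fracpart x = fracpart y <-> isint (x - y).
Proof.
rewrite /fracpart; split=> [E|[k E]].
  by exists (Num.floor x - Num.floor y); rewrite intrB; lra.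
have -> : x = y + k%:~R by lra.
by rewrite floorDrz ?intrD ?intrKfloor ?intr_int //; lra.
Qed.

(** Equal fractional parts amount to an integer difference; crossings are handled in this form from
    here on. *)
Lemma crE f g x : cr f g x <-> 0 <= x <= 1 /\ isint (ext f x - ext g x).
Proof.
split=> [[t /= /fracpart_eq tfg <-]|[x01 /fracpart_eq E]].
  by rewrite !ext_val set_val01.
by exists (clampI x) => //; rewrite set_val_clampI.
Qed.

Lemma supnorm_le (h : I01 R -> R) (e : R) :
  (forall t : I01 R, `|h t| <= e) -> supnorm h <= e.
Proof.
move=> H; apply: sup_le_ub; last by move=> _ [t _ <-].
by exists `|h (clampI 0)|, (clampI 0).
Qed.

Lemma finite_set_sorted (A : set R) : finite_set A ->
  exists2 s : seq R, sorted <%R s & A = [set` s].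
Proof.
move=> /finite_seqP[s ->]; exists (sort <=%R (undup s)).
  by rewrite sort_lt_sorted undup_uniq.
by apply/seteqP; split=> x /=; rewrite mem_sort mem_undup.
Qed.

Lemma not_local_extremum (h : I01 R -> R) t (eta : R) : 0 < eta -> 0 <= t <= 1 ->
  ~ local_extremum h (clampI t) ->
  ~ (forall x, 0 <= x <= 1 -> `|x - t| < eta -> h (clampI x) <= h (clampI t)) /\
  ~ (forall x, 0 <= x <= 1 -> `|x - t| < eta -> h (clampI t) <= h (clampI x)).
Proof.
move=> eta0 t01 nh.
have nt : \forall u \near clampI t, `|set_val u - t| < eta.
  have /cvgrPdist_lt /(_ _ eta0) := @initial_continuous _ _ set_val (clampI t).
  by rewrite set_val_clampI //; apply: filterS => u /=; rewrite distrC.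
split=> H; apply: nh; [left|right]; apply: filterS nt => u ut;
  by have := H _ (set_val01 u) ut; rewrite clampIK.
Qed.

End extension.

(** * Sign change at an isolated zero *)

Section sign_change.
Variable R : realType.
Implicit Types (f : R -> R) (x y t : R).

Lemma no_zero_same_sign f x y : continuous f -> x <= y ->
  (forall z, x <= z <= y -> f z != 0) -> (0 < f x) = (0 < f y).
Proof.
move=> cf xy nz; apply/idP/idP => H; rewrite ltNge; apply/negP => H'.
  have [||z zI fz] := @IVT R f x y 0 xy; first exact: continuous_subspaceT.
    by rewrite ge_min H' orbT le_max (ltW H).
  by move: zI; rewrite in_itv /= => /nz; rewrite fz eqxx.
have [||z zI fz] := @IVT R f x y 0 xy; first exact: continuous_subspaceT.
  by rewrite ge_min H' /= le_max (ltW H) orbT.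
by move: zI; rewrite in_itv /= => /nz; rewrite fz eqxx.
Qed.

(** By the intermediate value theorem f keeps one sign on each side of [t], and equal signs would
    make [t] an extremum. [sg] is the direction of the crossing: 1 upwards, -1 downwards. *)
Lemma isolated_zero_sign_change f t eta : continuous f -> 0 < eta -> f t = 0 ->
  (forall x, `|x - t| < eta -> x != t -> f x != 0) ->
  ~ (forall x, `|x - t| < eta -> f x <= 0) ->
  ~ (forall x, `|x - t| < eta -> 0 <= f x) ->
  exists2 sg : R, sg ^+ 2 = 1 &
    forall x, `|x - t| < eta -> 0 <= sg * ((x - t) * f x).
Proof.
move=> cf eta0 ft nz nle nge.
pose r := t + eta / 2; pose l := t - eta / 2.
have inr x y z : `|x - t| < eta -> `|y - t| < eta -> x <= z <= y -> `|z - t| < eta.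
  by rewrite !ltr_norml => /andP[? ?] /andP[? ?] /andP[? ?]; apply/andP; split; lra.
have rt : `|r - t| < eta by rewrite ltr_norml /r; apply/andP; split; lra.
have lt : `|l - t| < eta by rewrite ltr_norml /l; apply/andP; split; lra.
have right x : `|x - t| < eta -> t < x -> (0 < f x) = (0 < f r).
  move=> xt tx; have [xr|/ltW rx] := leP x r.
    apply: no_zero_same_sign => // z xzr; apply: nz; first exact: (inr x r).
    by case/andP: xzr => *; rewrite gt_eqF //; lra.
  apply/esym/no_zero_same_sign => // z rzx; apply: nz; first exact: (inr r x).
  by case/andP: rzx; rewrite /r => *; rewrite gt_eqF //; lra.
have left x : `|x - t| < eta -> x < t -> (0 < f x) = (0 < f l).
  move=> xt tx; have [xl|/ltW lx] := leP x l.
    apply: no_zero_same_sign => // z xzl; apply: nz; first exact: (inr x l).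
    by case/andP: xzl; rewrite /l => *; rewrite lt_eqF //; lra.
  apply/esym/no_zero_same_sign => // z lzx; apply: nz; first exact: (inr l x).
  by case/andP: lzx => *; rewrite lt_eqF //; lra.
have [fr|fr] := boolP (0 < f r); have [fl|fl] := boolP (0 < f l).
- exfalso; apply: nge => x xt; have [xlt|xlt|->] := ltgtP x t; last by rewrite ft.
    by rewrite ltW // left.
  by rewrite ltW // right.
- exists 1 => [|x xt]; first by rewrite expr1n.
  rewrite mul1r; have [xlt|xlt|->] := ltgtP x t; last by rewrite subrr mul0r.
    have : f x <= 0 by rewrite leNgt left.
    by move=> fx; apply: mulr_le0 => //; rewrite subr_le0 ltW.
  by apply: mulr_ge0; [rewrite subr_ge0 ltW|rewrite ltW // right].
- exists (-1) => [|x xt]; first by rewrite sqrrN expr1n.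
  rewrite mulN1r -mulrN; have [xlt|xlt|->] := ltgtP x t; last by rewrite subrr mul0r.
    by apply: mulr_le0; [rewrite subr_le0 ltW|rewrite oppr_le0 ltW // left].
  have : f x <= 0 by rewrite leNgt right.
  by move=> fx; apply: mulr_ge0; [rewrite subr_ge0 ltW|rewrite oppr_ge0].
- exfalso; apply: nle => x xt; have [xlt|xlt|->] := ltgtP x t; last by rewrite ft.
    by rewrite leNgt left.
  by rewrite leNgt right.
Qed.

End sign_change.

(** * A deterministic criterion for smooth density *)

Section smoothly_dense_criterion.
Variable R : realType.
Implicit Types (f g h : C01 R) (V F : set (C01 R)).

Definition lip_close (g : C01 R) (q : {poly R}) (d : R) :=
  (forall x, 0 <= x <= 1 -> `|ext g x - q.[x]| <= d) /\
  (forall x y, 0 <= x <= 1 -> 0 <= y <= 1 ->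
     `|(ext g x - q.[x]) - (ext g y - q.[y])| <= d * `|x - y|).

Lemma polyC01_lipschitz (p : {poly R}) : lipschitzC01 (polyC01 p).
Proof.
have [L _ HL] := poly_lipshitz p 0 1; exists L => s t; rewrite /= /polyfun.
by apply: HL; rewrite in_itv /= set_val01.
Qed.

(** The radius avoids the other crossings, which isolates the zero, and stays inside [0, 1], where
    extrema relative to the interval and to the line agree; this is where the exclusion of 0 and 1
    enters. *)
Lemma crossing_sign_change f (p : {poly R}) (t : R) (k : int) :
  finite_set (cr f (polyC01 p)) -> ~ cr f (polyC01 p) 0 -> ~ cr f (polyC01 p) 1 ->
  0 <= t <= 1 -> ext f t - p.[t] = k%:~R ->
  ~ local_extremum (fun u => f u - polyC01 p u) (clampI t) ->
  exists2 sg : R, sg ^+ 2 = 1 & exists2 eta : R, 0 < eta &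
    forall x, `|x - t| < eta -> 0 <= sg * ((x - t) * (ext f x - (p + k%:~R%:P).[x])).
Proof.
move=> fin n0 n1 t01 ftk next.
pose phi x := ext f x - (p + k%:~R%:P).[x].
have phiE x : phi x = ext f x - p.[x] - k%:~R by rewrite /phi hornerD hornerC; ring.
have ct : cr f (polyC01 p) t by apply/crE; split=> //; rewrite ext_poly //; exists k.
have {n0}t0 : 0 < t.
  case/andP: (t01) => + _; rewrite le_eqVlt => /orP[/eqP E|//].
  by exfalso; apply: n0; rewrite E.
have {n1}t1 : t < 1.
  case/andP: (t01) => _; rewrite le_eqVlt => /orP[/eqP E|//].
  by exfalso; apply: n1; rewrite -E.
have [s ss sE] := finite_set_sorted fin.
have [d1 d10 Hd1] : exists2 d : R, 0 < d & forall u c, u \in s -> 0 < c <= d ->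
    u != t -> c <= `|u - t|.
  apply: seq_uniform => u us; have [->|ut] := eqVneq u t; first by exists 1.
  by exists `|u - t| => [|c /andP[]//]; rewrite normr_gt0 subr_eq0.
pose eta := Num.min d1 (Num.min t (1 - t)).
have eta0 : 0 < eta by rewrite !lt_min d10 t0 subr_gt0.
have in01 x : `|x - t| < eta -> 0 <= x <= 1.
  rewrite !lt_min => /and3P[_]; rewrite !ltr_norml => /andP[? ?] /andP[? ?].
  by apply/andP; split; lra.
have cphi : continuous phi.
  by move=> x; apply: cvgB; [exact: ext_continuous|exact: continuous_horner].
have [nle nge] := not_local_extremum eta0 t01 next.
have pE x : 0 <= x <= 1 -> f (clampI x) - polyC01 p (clampI x) = phi x + k%:~R.
  by move=> x01; rewrite phiE -(ext_poly p x01) /ext; ring.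
have phit : phi t = 0 by rewrite phiE ftk subrr.
have [|||sg sg1 Hsg] := isolated_zero_sign_change cphi eta0 phit.
- move=> x xt xnt; apply/eqP => phix.
  have : cr f (polyC01 p) x.
    apply/crE; split; first exact: in01.
    by rewrite ext_poly ?in01 //; exists k; have := phiE x; lra.
  rewrite sE /= => /(Hd1 _ d1); rewrite d10 lexx => /(_ isT xnt).
  by move: xt; rewrite lt_min => /andP[+ _]; rewrite ltNge => /negP.
- move=> H; apply: nle => x x01 xt; rewrite !pE //.
  by have := H x xt; rewrite phit; lra.
- move=> H; apply: nge => x x01 xt; rewrite !pE //.
  by have := H x xt; rewrite phit; lra.
by exists sg => //; exists eta.
Qed.

(** By transversality each crossing [t] of f belongs to a single [h], and there f meets [b t], the
    translate of [h] by an integer. The targets at different points are therefore compatible, one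
    polynomial [q] serves all [h] at once, and [crossing_stability] passes from [q] to an element of
    [V]. *)
Lemma smoothly_dense_criterion V : countable V ->
  (forall h, V h -> exists p, h = polyC01 p) ->
  (forall (q : {poly R}) (d : R), 0 < d -> exists2 g, V g & lip_close g q d) ->
  transverse V -> smoothly_dense V.
Proof.
move=> cV Vpoly Vdense trV; split => //.
- move=> O [f Of] oO; have : nbhs f O by exact: open_nbhs_nbhs.
  move=> /nbhs_ballP[e /= e0 eO].
  have e3 : 0 < e / 3 by rewrite divr_gt0.
  have [q Hq] := weierstrass (@ext_continuous R f) e3.
  have [g Vg [gq _]] := Vdense q _ e3.
  exists g; split=> //; apply: eO; rewrite ballEmdist /= C01_mdistE.
  apply: (@le_lt_trans _ _ (2 * (e / 3))); last by lra.
  apply: supnorm_le => t; have t01 := set_val01 t.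
  rewrite -!ext_val; have := gq _ t01; have := Hq _ t01.
  have := ler_distD q.[set_val t] (ext f (set_val t)) (ext g (set_val t)).
  by rewrite (distrC (ext f _) q.[_]) (distrC q.[_]); lra.
- by move=> f /Vpoly[p ->]; exact: polyC01_lipschitz.
move=> F f e FV finF trF e0.
have [hs0 hs0E] : exists s : seq (C01 R), F = [set` s] by exact/finite_seqP.
pose hs := [seq h <- hs0 | h != f].
have hsP h : h \in hs <-> F h /\ h <> f.
  rewrite mem_filter hs0E /=; split=> [/andP[/eqP ? ?]//|[hh hf]].
  by rewrite hh andbT; apply/eqP.
have /choice[pl plE] h : exists p, F h -> h = polyC01 p.
  by have [/FV/Vpoly[p ->]|nF] := pselect (F h); [exists p|exists 0].
have trans h : h \in hs -> [/\ finite_set (cr f h), ~ cr f h 0, ~ cr f h 1 &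
    forall t : I01 R, cr f h (set_val t) -> ~ local_extremum (fun u => f u - h u) t].
  move=> /hsP[Fh hf]; apply: trF.2; [by right|by left|].
  by move=> E; apply: hf.
have /choice[sh shP] h : exists s : seq R, h \in hs ->
    sorted <%R s /\ cr f h = [set` s].
  have [/trans[/finite_set_sorted[s ? ?]]|_] := boolP (h \in hs); last by exists [::].
  by exists s.
have sh_cr h t : h \in hs -> t \in sh h <-> cr f h t.
  by move=> hhs; have [_ ->] := shP _ hhs.
have sh01 h t : h \in hs -> t \in sh h -> 0 < t < 1.
  move=> hhs /(sh_cr _ _ hhs) ct; have [_ n0 n1 _] := trans _ hhs.
  have /crE[/andP[t0 t1] _] := ct.
  rewrite !lt_neqAle t0 t1 !andbT; apply/andP; split; apply/eqP => E.
    by apply: n0; rewrite E.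
  by apply: n1; rewrite -E.
pose s := undup (flatten [seq sh h | h <- hs]).
have sP t : t \in s <-> exists2 h, h \in hs & t \in sh h.
  rewrite mem_undup; split=> [/flatten_mapP[h hhs ths]|[h hhs ths]]; first by exists h.
  by apply/flatten_mapP; exists h.
have shs h t : h \in hs -> t \in sh h -> t \in s by move=> ? ?; apply/sP; exists h.
have /choice[hh hhP] t : exists h, t \in s -> h \in hs /\ t \in sh h.
  by have [/sP[h ? ?]|_] := boolP (t \in s); [exists h|exists f].
(* Otherwise the distinct pairs {f, h} and {f, hh t} would share the crossing [t]. *)
have hh_uniq h t : h \in hs -> t \in sh h -> hh t = h.
  move=> hhs ths; have [hths tth] := hhP t (shs _ _ hhs ths).
  have [//|hne] := pselect (hh t = h); exfalso.
  have [Fh hf] := (hsP h).1 hhs; have [Fht htf] := (hsP (hh t)).1 hths.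
  have := trF.1 f h f (hh t) (or_intror erefl) (or_introl Fh) (or_intror erefl)
    (or_introl Fht) (fun E => hf (esym E)) (fun E => htf (esym E)).
  suff ne : [set f; h] <> [set f; hh t].
    move=> /(_ ne) E; suff : (set0 : set R) t by [].
    by rewrite -E; split; apply/sh_cr.
  move=> E; have : [set f; hh t] h by rewrite -E; right.
  by case=> [/hf//|/esym/hne].
have /choice[k kP] t : exists k : int, t \in s -> ext f t - (pl (hh t)).[t] = k%:~R.
  have [ts|_] := boolP (t \in s); last by exists 0.
  have [hhs /(sh_cr _ _ hhs)] := hhP _ ts; move=> /crE[t01 [k kE]]; exists k => _.
  by rewrite -kE {2}[hh t](plE) ?ext_poly //; have [] := (hsP _).1 hhs.
pose b t := pl (hh t) + (k t)%:~R%:P.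
have s01 t : t \in s -> 0 < t < 1.
  by move=> ts; have [hhs tsh] := hhP _ ts; exact: (sh01 (hh t)).
have w01 (t : R) : 0 < t < 1 -> 0 <= t <= 1.
  by move=> /andP[? ?]; apply/andP; split; exact: ltW.
have bf : {in s, forall t, (b t).[t] = ext f t}.
  by move=> t ts; rewrite hornerD hornerC; have := kP _ ts; lra.
have /choice[sg sgP] t : exists sg : R, t \in s -> sg ^+ 2 = 1 /\
    exists2 eta : R, 0 < eta & forall x, `|x - t| < eta ->
      0 <= sg * ((x - t) * (ext f x - (b t).[x])).
  have [ts|_] := boolP (t \in s); last by exists 0.
  have [hhs tsh] := hhP _ ts; have [Fh _] := (hsP _).1 hhs.
  have [fin n0 n1 next] := trans _ hhs.
  have t01 := w01 _ (s01 _ ts).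
  have := next (clampI t); rewrite set_val_clampI // -(sh_cr _ _ hhs) => /(_ tsh) {}next.
  move: fin n0 n1 next; rewrite {1 2 3}[hh t](plE) // => fin n0 n1.
  under eq_fun do rewrite {1}[hh t](plE) //.
  move=> next; have [sg ? ?] := crossing_sign_change fin n0 n1 t01 (kP _ ts) next.
  by exists sg.
have [eta eta0 Heta] : exists2 d : R, 0 < d & forall t c, t \in s -> 0 < c <= d ->
    forall x, `|x - t| < c -> 0 <= sg t * ((x - t) * (ext f x - (b t).[x])) /\
      `|ext f x - (b t).[x]| < 1 / 4.
  apply: seq_uniform => t ts; have [_ [d1 d10 Hd1]] := sgP _ ts.
  have cb : continuous (fun x => ext f x - (b t).[x]).
    by move=> x; apply: cvgB; [exact: ext_continuous|exact: continuous_horner].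
  have [d2 d20 Hd2] := continuous_dist t cb (divr_gt0 ltr01 (ltr0n _ 4)).
  exists (Num.min d1 d2); first by rewrite lt_min d10.
  move=> c /andP[c0]; rewrite le_min => /andP[cd1 cd2] x xt; split.
    by apply: Hd1; exact: lt_le_trans cd1.
  by have := Hd2 x (lt_le_trans xt cd2); rewrite (bf _ ts) subrr subr0.
have [||eta' /andP[eta'0 eta'eta] Happ] :=
    @simple_crossing_approx R (ext f) s b sg eta (@ext_continuous R f) (undup_uniq _) eta0 bf.
- by move=> t /sgP[].
- by move=> t ts x xt; apply: (Heta t eta ts _ x xt).1; rewrite eta0 /=.
have [c c0 Hc] : exists2 c : R, 0 < c & forall h c', h \in hs -> 0 < c' <= c ->
    forall x, 0 <= x <= 1 -> {in sh h, forall t, eta' <= `|x - t|} ->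
    forall j : int, c' <= `|ext f x - (pl h).[x] - j%:~R|.
  apply: seq_uniform => h hhs; have [Fh _] := (hsP _).1 hhs.
  have [||c c0 Hc] := @segment_int_gap R (fun x => ext f x - (pl h).[x]) (sh h) eta' _ eta'0.
  - by move=> x; apply: cvgB; [exact: ext_continuous|exact: continuous_horner].
  - by move=> x x01 ix; apply/sh_cr => //; apply/crE; rewrite [h]plE ?ext_poly.
  exists c => // c' /andP[_ c'c] x x01 far j; exact: le_trans (Hc x x01 far j).
(* [c] rules out crossings of [q] away from [sh h]; 1/4, added to the 1/4 of [Heta], forces the
   level [k t] near [t]; [e / 3] is one of the two errors whose sum must stay below [e]. *)
pose e1 := Num.min c (Num.min (1 / 4) (e / 3)).
have e10 : 0 < e1 by rewrite !lt_min c0 !divr_gt0.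
have [e1c [e14 e1e]] : e1 <= c /\ e1 <= 1 / 4 /\ e1 <= e / 3.
  by have := lexx e1; rewrite {2}/e1 !le_min => /and3P[? ? ?]; do !split.
have [q qf qb] := Happ e1 e10.
(* A crossing of [q] and [h] near [t] is at the level [k t], hence a zero of [('X - t%:P) * r]; as
   [r] does not vanish there, it is [t] itself. *)
have crq h : h \in hs -> forall x, 0 <= x <= 1 ->
    isint (q - pl h).[x] <-> x \in sh h.
  move=> hhs x x01; split=> [[j]|xsh].
    rewrite hornerD hornerN => jE; have qfx := qf _ x01.
    have [far|/existsNP[t /not_implyP[ts /negP]]] :=
        pselect {in sh h, forall t, eta' <= `|x - t|}.
      have := Hc h c hhs ltac:(by rewrite c0 /=) x x01 far j.
      have -> : ext f x - (pl h).[x] - j%:~R = - (q.[x] - ext f x) by lra.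
      by rewrite normrN; lra.
    rewrite -ltNge => xt; have ts' := shs _ _ hhs ts.
    have [r rE rsg] := qb _ ts'.
    have [|_ fb] := Heta t eta ts' _ x (lt_le_trans xt eta'eta); first by rewrite eta0 /=.
    have bx : (b t).[x] = (pl h).[x] + (k t)%:~R.
      by rewrite hornerD hornerC (hh_uniq h).
    have jk : j = k t.
      apply: (@int_dist_lt1 R).
      have -> : j%:~R - (k t)%:~R = (q.[x] - ext f x) + (ext f x - (b t).[x]) by lra.
      by apply: (le_lt_trans (ler_normD _ _)); lra.
    have /(congr1 (horner^~ x)) := rE; rewrite hornerD hornerN hornerM hornerXsubC.
    have -> : q.[x] - (b t).[x] = 0 by rewrite bx -jk; lra.
    move=> /esym/eqP; rewrite mulf_eq0 subr_eq0 => /orP[/eqP->//|/eqP rx0].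
    by have := rsg x x01 xt; rewrite rx0 mulr0 ltxx.
  have xs := shs _ _ hhs xsh; have [r rE _] := qb _ xs; exists (k x).
  have /(congr1 (horner^~ x)) := rE.
  rewrite hornerM hornerXsubC subrr mul0r /b !(hornerD, hornerN) hornerC (hh_uniq h) //.
  lra.
(* At the root [t] the derivative of [('X - t%:P) * r] is [r.[t]], whose sign is prescribed. *)
have derq h : h \in hs -> {in sh h, forall t, (q - pl h)^`().[t] != 0}.
  move=> hhs t tsh; have ts := shs _ _ hhs tsh; have [r rE rsg] := qb _ ts.
  have -> : (q - pl h)^`() = (q - b t)^`().
    by rewrite !derivB derivD derivC addr0 (hh_uniq h).
  rewrite rE derivM derivXsubC mul1r hornerD hornerM hornerXsubC subrr mul0r addr0.
  apply/eqP => rt; have := rsg t (w01 _ (s01 _ ts)).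
  by rewrite subrr normr0 rt mulr0 ltxx => /(_ eta'0).
have [d d0 Hd] : exists2 d : R, 0 < d & forall h c, h \in hs -> 0 < c <= d ->
    forall g, lip_close g q c -> exists s' : seq R, [/\ sorted <%R s',
      forall x, x \in s' <-> 0 <= x <= 1 /\ isint (ext g x - (pl h).[x]),
      size (sh h) = size s' &
      forall i, (i < size (sh h))%N -> `|(sh h)`_i - s'`_i| < e].
  apply: seq_uniform => h hhs.
  have [sorth _] := shP _ hhs.
  have [d d0 Hd] := crossing_stability e0 sorth (fun t => @sh01 h t hhs) (crq _ hhs) (derq _ hhs).
  exists d => // c' /andP[c'0 c'd] g [g1 g2].
  have E x : ext g x - (pl h).[x] - (q - pl h).[x] = ext g x - q.[x].
    by rewrite hornerD hornerN; ring.
  apply: Hd.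
  - by move=> x; apply: cvgB; [exact: ext_continuous|exact: continuous_horner].
  - by move=> x x01; rewrite E; exact: le_trans (g1 _ x01) c'd.
  - move=> x y x01 y01; rewrite !E; apply: le_trans (g2 _ _ x01 y01) _.
    exact: ler_wpM2r.
have de0 : 0 < Num.min d (e / 3) by rewrite lt_min d0 divr_gt0.
have [g Vg gq] := Vdense q _ de0.
exists g; split=> //.
  apply: (@le_lt_trans _ _ (2 * (e / 3))); last by lra.
  apply: supnorm_le => t; have t01 := set_val01 t.
  have de3 : Num.min d (e / 3) <= e / 3 by rewrite ge_min lexx orbT.
  rewrite -!ext_val; have := gq.1 _ t01; have := qf _ t01.
  have := ler_distD q.[set_val t] (ext f (set_val t)) (ext g (set_val t)).
  by rewrite (distrC (ext f _) q.[_]) (distrC q.[_]); lra.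
move=> h Fh hf; have hhs : h \in hs by apply/hsP.
have [|s' [ss' s'E szs' s'e]] := Hd h _ hhs _ g gq; first by rewrite de0 ge_min lexx.
have [sorth crh] := shP _ hhs.
exists (sh h), s'; split=> //; split=> //.
apply/seteqP; split=> x /=.
  by move=> /crE[x01 ix]; apply/s'E; split=> //; rewrite -ext_poly // -plE.
by move=> /s'E[x01 ix]; apply/crE; split=> //; rewrite [h]plE // ext_poly.
Qed.

End smoothly_dense_criterion.

(** * Independence and small-ball estimates *)

Section independence_grouping.
Context {d} {T : measurableType d} {R : realType} (P : probability T R).
Context {I : choiceType} (G : I -> set_system T).
Hypothesis Gm : forall i A, G i A -> measurable A.
Hypothesis GI : forall i, setI_closed (G i).
Hypothesis GT : forall i, G i setT.
Hypothesis Gindep : indep_systems P G.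
Local Open Scope ereal_scope.

Let cylinders l : set_system T :=
  [set E | exists (J : {fset I}) (D : I -> set T),
    [/\ l \notin J, forall i, G i (D i) & E = \bigcap_(i in [set` J]) D i]].

Let cylinders_setI l : setI_closed (cylinders l).
Proof.
move=> _ _ [J [D [lJ GD ->]]] [J' [D' [lJ' GD' ->]]].
exists (J `|` J')%fset, (fun i => (if i \in J then D i else setT) `&`
                                 (if i \in J' then D' i else setT)); split.
- by rewrite inE negb_or lJ.
- by move=> i; apply: GI; case: ifP.
- apply/seteqP; split=> [w [H H'] i /= |w H].
    by rewrite inE => _; split; case: ifP => // iJ; [exact: H|exact: H'].
  split=> i /= iJ.
    by have [] := H i; rewrite /= ?inE iJ.
  by have [] := H i; rewrite /= ?inE iJ ?orbT.
Qed.

Let indep_cylinders l A E : G l A -> cylinders l E -> P (A `&` E) = P A * P E.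
Proof.
move=> GA [J [D [lJ GD ->]]].
pose D' i := if i == l then A else D i.
have D'J i : i \in J -> D' i = D i.
  by rewrite /D'; case: eqP => // -> iJ; rewrite iJ in lJ.
have -> : A `&` \bigcap_(i in [set` J]) D i = \bigcap_(i in [set` (l |` J)%fset]) D' i.
  apply/seteqP; split=> [w [wA wD] i /=|w H].
    by rewrite !inE => /orP[/eqP->|iJ]; [rewrite /D' eqxx|rewrite D'J //; exact: wD].
  split; first by have := H l; rewrite /= !inE eqxx /D' eqxx; exact.
  by move=> i /= iJ; rewrite -D'J //; apply: H; rewrite /= !inE iJ orbT.
rewrite Gindep; last by move=> i _; rewrite /D'; case: eqP => [->|].
rewrite big_fsetU1 //= {1}/D' eqxx; congr (_ * _).
rewrite Gindep // big_seq [RHS]big_seq.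
by apply: eq_bigr => i iJ; rewrite D'J.
Qed.

Definition other_events l : set_system T := \bigcup_(i in [set~ l]) G i.

Lemma other_events_measurable l E : <<s other_events l >> E -> measurable E.
Proof.
apply: smallest_sub; first exact: sigma_algebra_measurable.
by move=> A [i _ /Gm].
Qed.

(** Dynkin's argument: finite intersections of events of the other indices are stable under
    intersection and satisfy the product rule by hypothesis, and the events independent of [A] form
    a Dynkin system. It applies to variables built from infinitely many other indices, such as a
    polynomial of random degree. *)
Lemma indep_other l A E : G l A -> <<s other_events l >> E -> P (A `&` E) = P A * P E.
Proof.
move=> GA; pose H := [set E : set T | measurable E /\ P (A `&` E) = P A * P E].
have mA := Gm GA.
have cyl_m B : cylinders l B -> measurable B.
  move=> [J [D [_ GD ->]]]; apply: fin_bigcap_measurable => //.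
  by move=> i _; exact: (Gm (GD i)).
have oc : other_events l `<=` cylinders l.
  move=> B [i il GB]; exists [fset i]%fset, (fun j => if j == i then B else setT).
  split=> [|j|].
  - by rewrite inE; apply/eqP => E'; apply: il.
  - by case: eqP => [->|].
  - apply/seteqP; split=> [w wB j /=|w /(_ i)]; first by rewrite inE => /eqP ->; rewrite eqxx.
    by rewrite /= inE eqxx; apply.
suff sub : <<s cylinders l >> `<=` H.
  move=> HE; apply: (proj2 (sub E _)).
  by move: HE; apply: sub_smallest2r => //; exact: smallest_sigma_algebra.
apply: (lambda_system_subset (@cylinders_setI l)); [| |by []].
  apply/dynkin_lambda_system; split.
  - by split=> //; rewrite setIT probability_setT mule1.
  - move=> B [mB PB]; split; first exact: measurableC.
    have fA := fin_num_measure P A mA.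
    by rewrite -setDE measureD ?ltey_eq ?fA // probability_setC // muleBr ?mule1 // -PB.
  - move=> F tF HF; split; first by apply: bigcupT_measurable => n; have [] := HF n.
    rewrite setI_bigcupr measure_bigcup //; last first.
    - exact: trivIset_setIl.
    - by move=> n _; apply: measurableI => //; have [] := HF n.
    rewrite measure_bigcup //; last by move=> n _; have [] := HF n.
    rewrite -(fineK (fin_num_measure P A mA)) -nneseriesZl //.
    apply: eq_eseriesr => n _; have [_ PF] := HF n.
    by rewrite fineK ?fin_num_measure //= PF.
by move=> B cB; split; [exact: cyl_m|exact: (indep_cylinders GA cB)].
Qed.

End independence_grouping.

Section small_ball.
Context {d} {T : measurableType d} {R : realType} (P : probability T R).
Local Open Scope ereal_scope.

Definition near_value (X : T -> R) (y r : R) : set T := [set w | `|X w - y| <= r]%R.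

Lemma near_valueE (X : T -> R) (y r : R) : near_value X y r = X @^-1` `[(y - r)%R, (y + r)%R].
Proof. by apply/seteqP; split=> w; rewrite /near_value /= in_itv /= ler_distl. Qed.

Lemma measurable_near_value (X : T -> R) (y r : R) :
  measurable_fun setT X -> measurable (near_value X y r).
Proof. by move=> mX; rewrite near_valueE -[X in measurable X]setTI; exact: mX. Qed.

(** Replaces conditioning on Y by slicing: if [|Y|] lies in [[m r, (m + 1) r)] and X is within r of
    Y, then X is within [2 r] of [m r] or of [- m r]. Two balls of radius [2 r] account for the
    factor 4. Carrying [E] along allows the estimate to be applied twice in succession. *)
Lemma small_ball_indep (G : set_system T) (X Y : T -> R) (C : R) : (0 <= C)%R ->
  (forall E, <<s G >> E -> measurable E) ->
  measurable_fun setT X ->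
  (forall E y (r : R), <<s G >> E -> (0 < r)%R ->
     P (E `&` near_value X y r) <= (C * r)%:E * P E) ->
  measurable_fun [set: g_sigma_algebraType G] (Y : g_sigma_algebraType G -> R) ->
  forall E (r : R), <<s G >> E -> (0 < r)%R ->
    P (E `&` near_value (fun w => X w - Y w)%R 0 r) <= (4 * C * r)%:E * P E.
Proof.
move=> C0 Gm mX ball mY E r GE r0.
pose D m : set R := (fun y : R => `|y|%R) @^-1` `[(m%:R * r)%R, (m.+1%:R * r)%R[.
have mD m : measurable (D m).
  by rewrite -[D m]setTI; exact: (@normr_measurable R setT measurableT).
pose Em m := E `&` Y @^-1` D m.
have GEm m : <<s G >> (Em m).
  have : measurable ((E : set (g_sigma_algebraType G)) `&` Y @^-1` D m).
    apply: measurableI; first exact: GE.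
    by rewrite -[X in measurable X]setTI; exact: mY.
  exact.
have mEm m := Gm _ (GEm m).
have mYT : measurable_fun setT Y.
  move=> _ B mB; rewrite setTI; apply: Gm.
  have : measurable ([set: g_sigma_algebraType G] `&` Y @^-1` B) by exact: mY.
  by rewrite setTI; exact.
have mXY : measurable_fun setT (fun w => X w - Y w)%R by exact: measurable_funB.
have mN := measurable_near_value 0 r mXY.
have tD : trivIset setT D.
  apply/trivIsetP => i j _ _ ij; apply/seteqP; split=> // y [].
  rewrite /D /= !in_itv /= => /andP[a1 a2] /andP[b1 b2].
  have : (i%:R * r < j.+1%:R * r)%R by exact: le_lt_trans b2.
  have : (j%:R * r < i.+1%:R * r)%R by exact: le_lt_trans a2.
  rewrite !ltr_pM2r // !ltr_nat !ltnS => ji ij'.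
  by move/eqP: ij; apply; apply/eqP; rewrite eqn_leq ij' ji.
have ED : E = \bigcup_m Em m.
  apply/seteqP; split=> [w Ew|w [m _ []]//].
  exists (Num.truncn (`|Y w| / r)) => //; split=> //.
  have : (0 <= `|Y w| / r)%R by rewrite divr_ge0 // ltW.
  move=> /truncn_itv; rewrite /D /= in_itv /= ler_pdivlMr // ltr_pdivrMr //.
have bound m : P (Em m `&` near_value (fun w => X w - Y w)%R 0 r) <=
    (4 * C * r)%:E * P (Em m).
  have r20 : (0 < 2 * r)%R by rewrite mulr_gt0.
  have mX1 := measurable_near_value (m%:R * r)%R (2 * r)%R mX.
  have mX2 := measurable_near_value (- (m%:R * r))%R (2 * r)%R mX.
  apply: (@le_trans _ _ (P ((Em m `&` near_value X (m%:R * r)%R (2 * r)%R) `|`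
                           (Em m `&` near_value X (- (m%:R * r))%R (2 * r)%R)))).
    apply: le_measure; rewrite ?inE.
    - exact: measurableI.
    - by apply: measurableU; exact: measurableI.
    - move=> w [Ew]; rewrite /near_value /= subr0.
      have := Ew => -[_]; rewrite /D /= in_itv /= -natr1 mulrDl mul1r => /andP[y1 y2] xy.
      have [Y0|Y0] := leP 0%R (Y w); [left|right]; split=> //=.
        move: y1 y2 xy; rewrite ger0_norm // !ler_norml => ? ? /andP[? ?].
        by apply/andP; split; lra.
      move: y1 y2 xy; rewrite ltr0_norm // !ler_norml => ? ? /andP[? ?].
      by apply/andP; split; lra.
  apply: (le_trans (measureU2 _ _ _)); [exact: measurableI|exact: measurableI|].
  apply: (@le_trans _ _ ((C * (2 * r))%:E * P (Em m) + (C * (2 * r))%:E * P (Em m))).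
    by apply: leeD; exact: ball.
  rewrite -(fineK (fin_num_measure P _ (mEm m))) -!EFinM -EFinD lee_fin.
  by rewrite -mulrDl ler_wpM2r ?fine_ge0 //; lra.
apply: (@le_trans _ _ (\sum_(0 <= m <oo) P (Em m `&` near_value (fun w => X w - Y w)%R 0 r))).
  apply: measure_sigma_subadditive.
  - by move=> m; exact: measurableI.
  - by apply: measurableI => //; exact: Gm.
  - by rewrite {1}ED setI_bigcupl.
apply: (@le_trans _ _ (\sum_(0 <= m <oo) (4 * C * r)%:E * P (Em m))).
  by apply: lee_nneseries => // m _; exact: measure_ge0.
rewrite nneseriesZl // [in leRHS]ED measure_bigcup //; last first.
  apply: trivIset_setIl; apply/trivIsetP => i j _ _ ij.
  by move/trivIsetP: tD => /(_ i j I I ij) DE; rewrite -preimage_setI DE preimage_set0.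
apply: lee_wpmul2l; first by rewrite lee_fin !mulr_ge0 // ltW.
by under [leRHS]eq_eseriesl do rewrite in_setT.
Qed.

End small_ball.

(** * Bounds for the normal and Poisson laws *)

Section normal_bounds.
Variable R : realType.
Local Notation mu := (@lebesgue_measure R).
Local Open Scope ereal_scope.

Lemma normal_itv_le (y r : R) : (0 < r)%R ->
  normal_prob 0 1 `[(y - r)%R, (y + r)%R]%classic <= (2 * normal_peak 1 * r)%:E :> \bar R.
Proof.
move=> r0; rewrite /normal_prob.
apply: (@le_trans _ _ (\int[mu]_(x in `[(y - r)%R, (y + r)%R]%classic) (cst (normal_peak 1)%:E x))).
  apply: ge0_le_integral => //.
  - by move=> x _; rewrite lee_fin normal_pdf_ge0.
  - apply/measurable_EFinP; apply: measurable_funTS; exact: measurable_normal_pdf.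
  - by move=> x _; rewrite lee_fin normal_pdf_ub // oner_neq0.
rewrite integral_cst //= lebesgue_measure_itv /= lte_fin ifT; last by lra.
by rewrite -EFinB -EFinM lee_fin; lra.
Qed.

Lemma normal_itv_gt0 (y r : R) : (0 < r)%R ->
  0 < normal_prob 0 1 `[(y - r)%R, (y + r)%R]%classic :> \bar R.
Proof.
move=> r0; rewrite /normal_prob.
have yr : (y - r <= y + r)%R by lra.
have [|c _ Hc] := @EVT_min R (normal_pdf 0 1) _ _ yr.
  by apply: continuous_subspaceT; apply: continuous_normal_pdf; rewrite oner_neq0.
have c0 : (0 < normal_pdf 0 1 c :> R)%R.
  rewrite normal_pdfE ?oner_neq0 //; apply: mulr_gt0; last exact: expR_gt0.
  by apply: normal_peak_gt0; rewrite oner_neq0.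
apply: (@lt_le_trans _ _ (\int[mu]_(x in `[(y - r)%R, (y + r)%R]%classic) (cst (normal_pdf 0 1 c)%:E x))).
  rewrite integral_cst //= lebesgue_measure_itv /= lte_fin ifT; last by lra.
  by rewrite -EFinB -EFinM lte_fin mulr_gt0 //; lra.
apply: ge0_le_integral => //.
- by move=> x _; rewrite lee_fin ltW.
- apply/measurable_EFinP; apply: measurable_funTS; exact: measurable_normal_pdf.
Qed.

Lemma poisson1_gt0 (n k : nat) : 0 < poisson_prob (1 : R) k [set n].
Proof.
rewrite /poisson_prob ltr01 esum_set1 ?lee_fin ?poisson_pmf_ge0 //.
by rewrite lte_fin /poisson_pmf ltr01 !mulr_gt0 ?expR_gt0 ?exprn_gt0 ?invr_gt0 ?ltr0n ?fact_gt0.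
Qed.

End normal_bounds.

(** * The law of the random polynomial *)

Section evaluation.
Variable R : realType.
Implicit Types (f g : C01 R) (x y : R).

Lemma le_mdist_ext f g x : `|ext f x - ext g x| <= mdist f g.
Proof. by apply: (sup_upper_bound (has_sup_normB f g)); exists (clampI x). Qed.

Lemma ext_eval_continuous x : continuous (fun g => ext g x).
Proof.
move=> f; apply/(@pseudometric_normed_Zmodule.cvgrPdist_lt _ _ _ _ (nbhs_filter f)) => e e0; apply/nbhs_ballP; exists e => //= g.
by rewrite ballEmdist /= => fg; apply: le_lt_trans fg; exact: le_mdist_ext.
Qed.

Lemma borelC01_open (A : set (C01 R)) :
  open A -> measurable (A : set (borelC01 R)).
Proof. by move=> oA; exact: sub_sigma_algebra. Qed.

Lemma borelC01_closed (A : set (C01 R)) :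
  closed A -> measurable (A : set (borelC01 R)).
Proof.
move=> cA; rewrite -[A]setCK; apply: measurableC.
by apply: borelC01_open; rewrite openC.
Qed.

Lemma ext_eval_measurable x :
  measurable_fun [set: borelC01 R] (fun g : borelC01 R => ext g x).
Proof.
apply: (measurability _ (RGenOpens.measurableE R)) => _ [_ [a [b ->] <-]].
rewrite setTI; apply: borelC01_open.
have /continuousP := @ext_eval_continuous x; apply; exact: interval_open.
Qed.

Definition polys : set (borelC01 R) := range (@polyC01 R).

Let node (i : nat) : R := i.+1%:R^-1.

Let node01 i : 0 <= node i <= 1.
Proof. by rewrite /node invr_ge0 ler0n /= invf_le1 ?ler1n // ltr0n. Qed.

Let node_inj : injective node.
Proof.
move=> i j /(congr1 GRing.inv); rewrite /node !invrK => /eqP.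
by rewrite eqr_nat => /eqP[].
Qed.

(* Polynomials of size at most [n] are exactly the functions that coincide with
   their Lagrange interpolant at [n] nodes, which is a closed condition. *)
Let lagrange_defect n x g : R :=
  ext g x - \sum_(i < n) ext g (node i) * (tnth (@lagrange R n node) i).[clamp x].

Let lagrange_defect_continuous n x : continuous (lagrange_defect n x).
Proof.
have ev y (g : C01 R) : {for g, continuous (fun h : C01 R => ext h y)}.
  exact: ext_eval_continuous.
move=> g; apply: (@cvgB _ _ _ _ (nbhs_filter g)); first exact: (ev x g).
apply: (cvg_big add_continuous (nbhs_filter g)) => i _.
apply: (@cvgM _ _ _ (nbhs_filter g)); first exact: (ev (node i) g).
exact: cvg_cst.
Qed.

(** A countable union, over the number of nodes, of closed sets. The law is prescribed on Borel sets
    only, so this precedes any claim that the functions are almost surely polynomials. *)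
Lemma polys_measurable : measurable polys.
Proof.
have -> : polys = \bigcup_n \bigcap_x (lagrange_defect n.+1 x @^-1` [set 0]).
  apply/seteqP; split=> [_ [p _ <-]|g [n _ Hg]].
    exists (size p) => // x _.
    change (lagrange_defect (size p).+1 x (polyC01 p) = 0).
    apply/eqP; rewrite subr_eq0; apply/eqP.
    have -> : ext (polyC01 p) x = p.[clamp x] by [].
    rewrite {1}(@lagrange_gen R (size p).+1 node isT node_inj p (leqnSn _)) horner_sum.
    by apply: eq_bigr => i _; rewrite hornerM hornerC ext_poly.
  exists (\sum_(i < n.+1) (ext g (node i))%:P * tnth (@lagrange R n.+1 node) i) => //.
  apply/continuousEP => t; have /eqP := Hg (set_val t) I.
  rewrite subr_eq0 ext_val => /eqP ->; rewrite /= /polyfun horner_sum.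
  rewrite clamp_id ?set_val01 //; apply: eq_bigr => i _.
  by rewrite hornerM hornerC.
apply: bigcupT_measurable => n; apply: borelC01_closed.
apply: closed_bigI => x _; have /continuous_closedP := @lagrange_defect_continuous n.+1 x.
by apply; exact: (@closed_eq R 0).
Qed.

End evaluation.

(** Serves the random degree: on each of the countably many events [N = n] the sum has a fixed
    length. *)
Lemma measurable_nat_index d (T : measurableType d) (R : realType)
    (N : T -> nat) (F : nat -> T -> R) : measurable_fun setT N ->
  (forall n, measurable_fun setT (F n)) -> measurable_fun setT (fun w => F (N w) w).
Proof.
move=> mN mF _ B mB; rewrite setTI.
have -> : (fun w => F (N w) w) @^-1` B =
    \bigcup_n (N @^-1` [set n] `&` F n @^-1` B).
  by apply/seteqP; split=> [w Bw|w [n _ [/= <-]]//]; exists (N w).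
apply: bigcupT_measurable => n; apply: measurableI; rewrite -[X in measurable X]setTI.
  exact: mN.
exact: mF.
Qed.

Section preimage_events.
Context {d} {T : measurableType d} {d'} {U : measurableType d'} (X : T -> U).

Lemma preimage_event (B : set U) : measurable B -> g_sigma_algebra_preimage X (X @^-1` B).
Proof. by move=> mB; exists B => //; rewrite setTI. Qed.

Lemma preimage_eventT : g_sigma_algebra_preimage X setT.
Proof. by rewrite -(preimage_setT X); exact: preimage_event. Qed.

Lemma preimage_eventI : setI_closed (g_sigma_algebra_preimage X).
Proof.
move=> _ _ [A mA <-] [B mB <-]; rewrite !setTI -preimage_setI.
by apply: preimage_event; exact: measurableI.
Qed.

Lemma preimage_event_measurable (A : set T) : measurable_fun setT X ->
  g_sigma_algebra_preimage X A -> measurable A.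
Proof. by move=> mX [B mB <-]; exact: mX. Qed.

Lemma measurable_fun_sub (G : set_system T) :
  g_sigma_algebra_preimage X `<=` G ->
  measurable_fun [set: g_sigma_algebraType G] (X : g_sigma_algebraType G -> U).
Proof.
move=> XG _ B mB; rewrite setTI; apply: sub_sigma_algebra; apply: XG.
exact: preimage_event.
Qed.

End preimage_events.

Lemma countType_bigcap_measurable d (T : measurableType d) (J : countType)
    (F : J -> set T) : (forall i, measurable (F i)) -> measurable (\bigcap_i F i).
Proof.
move=> mF; have -> : \bigcap_i F i =
    \bigcap_n (if (@choice.unpickle J n) is Some i then F i else setT).
  apply/seteqP; split=> [w H n _|w H i _].
    by case: (@choice.unpickle J n) => // i; exact: H.
  by have := H (choice.pickle i) I; rewrite choice.pickleK.
by apply: bigcapT_measurable => n; case: (@choice.unpickle J n).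
Qed.

Lemma rat_nonneg (R : realType) (f : R -> R) : continuous f ->
  (forall q : rat, 0 <= f (ratr q)) -> forall x, 0 <= f x.
Proof.
move=> cf fq x; rewrite leNgt; apply/negP => fx.
have nfx : 0 < - f x by rewrite oppr_gt0.
have [e e0 He] := continuous_dist x cf nfx.
have [q] : exists q, ratr q \in `]x - e, x + e[ by apply: rat_in_itvoo; lra.
rewrite in_itv /= => /andP[q1 q2].
have := He (ratr q); rewrite ltr_norml => /(_ ltac:(apply/andP; split; lra)).
by have := fq q; rewrite ltr_norml => ? /andP[]; lra.
Qed.

(** * Borel neighbourhoods of a polynomial in the Lipschitz seminorm *)

Section lip_set.
Variable R : realType.

(** A version of [lip_close] with countably many conditions: one anchor at 0 and the increments
    between rational points, clamped so that all rationals may be used. *)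
Definition lip_set (q : {poly R}) (e : R) : set (borelC01 R) :=
  [set g | `|ext g 0 - q.[0]| <= e] `&`
  \bigcap_(p : rat * rat) [set g |
    `|(ext g (ratr p.1) - q.[clamp (ratr p.1)]) -
      (ext g (ratr p.2) - q.[clamp (ratr p.2)])| <=
    e * `|clamp (ratr p.1) - clamp (ratr p.2)|].

Lemma measurable_le_const d (T : measurableType d) (X : T -> R) (c : R) :
  measurable_fun setT X -> measurable [set w | `|X w| <= c].
Proof.
move=> mX; have := measurable_near_value 0 c mX.
by rewrite /near_value; under eq_set do rewrite subr0.
Qed.

(** Stated through evaluations so as to cover both the identity of [borelC01] and [random_poly], of
    which only the evaluations are shown to be measurable. *)
Lemma preimage_lip_set_measurable d (T : measurableType d)
    (Z : T -> borelC01 R) q e :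
  (forall x, measurable_fun setT (fun w => ext (Z w) x)) ->
  measurable (Z @^-1` lip_set q e).
Proof.
move=> mZ; rewrite /lip_set preimage_setI; apply: measurableI.
  by apply: measurable_le_const; apply: measurable_funB => //; exact: measurable_cst.
rewrite preimage_bigcap; apply: countType_bigcap_measurable => p.
by apply: measurable_le_const; do 2![apply: measurable_funB => //];
  exact: measurable_cst.
Qed.

Lemma lip_set_measurable q e : measurable (lip_set q e).
Proof.
have := @preimage_lip_set_measurable _ (borelC01 R) id q e.
by rewrite preimage_id; apply=> x; exact: ext_eval_measurable.
Qed.

(** Continuity carries the increment bound from rational to real points; the anchor at 0 plus an
    increment over a length at most 1 explains the factor 2 in the uniform bound. *)
Lemma lip_set_close q (e : R) (g : C01 R) : 0 <= e -> lip_set q e g -> lip_close g q (2 * e).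
Proof.
move=> e0 [g0 gL].
pose D x := ext g x - q.[clamp x].
have cD : continuous D.
  move=> x; apply: cvgB; first exact: ext_continuous.
  apply: (@continuous_comp _ _ _ (@clamp R) (horner q)); first exact: clamp_continuous.
  exact: continuous_horner.
have cn (h1 h2 : R -> R) : continuous h1 -> continuous h2 ->
    continuous (fun x => e * `|h1 x| - `|h2 x|).
  move=> c1 c2 x; apply: cvgB; last by apply: cvg_norm; exact: c2.
  by apply: cvgM; [exact: cvg_cst|apply: cvg_norm; exact: c1].
have L x y : `|D x - D y| <= e * `|clamp x - clamp y|.
  rewrite -subr_ge0.
  apply: (@rat_nonneg _ (fun x => e * `|clamp x - clamp y| - `|D x - D y|)) => [|p].
    by apply: cn => u; apply: cvgB; try exact: cvg_cst; [exact: clamp_continuous|exact: cD].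
  apply: (@rat_nonneg _ (fun y => e * `|clamp (ratr p) - clamp y| - `|D (ratr p) - D y|)) => [|p'].
    by apply: cn => u; apply: cvgB; try exact: cvg_cst; [exact: clamp_continuous|exact: cD].
  by rewrite subr_ge0; exact: (gL (p, p') I).
have DE x : 0 <= x <= 1 -> ext g x - q.[x] = D x by move=> x01; rewrite /D clamp_id.
have z01 : 0 <= (0 : R) <= 1 by rewrite lexx ler01.
split=> [x x01|x y x01 y01].
  have := L x 0; rewrite !clamp_id // subr0 -DE // -(DE 0) // => L0.
  have : e * `|x| <= e by rewrite ler_piMr //; move: x01 => /andP[? ?]; rewrite ger0_norm.
  move: g0 L0 => /= g0 L0 xe.
  have := ler_normD (ext g x - q.[x] - (ext g 0 - q.[0])) (ext g 0 - q.[0]).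
  by rewrite subrK; lra.
have := L x y; rewrite !clamp_id // -!DE // => Lxy; apply: (le_trans Lxy).
by apply: ler_wpM2r => //; lra.
Qed.

End lip_set.

Lemma expr_lipschitz (R : realType) (x y : R) k : 0 <= x <= 1 -> 0 <= y <= 1 ->
  `|x ^+ k - y ^+ k| <= k%:R * `|x - y|.
Proof.
move=> /andP[x0 x1] /andP[y0 y1]; elim: k => [|k IH].
  by rewrite !expr0 subrr normr0 mul0r.
rewrite !exprS (_ : _ - _ = x * (x ^+ k - y ^+ k) + (x - y) * y ^+ k); last by ring.
apply: (le_trans (ler_normD _ _)); rewrite -natr1 [leRHS]mulrDl mul1r !normrM.
apply: lerD; first by apply: le_trans IH; rewrite ler_piMl // ger0_norm.
by rewrite ler_piMr // ger0_norm ?exprn_ge0 // exprn_ile1.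
Qed.

Lemma small_coef_lipschitz (R : realType) n (c : nat -> R) (r : R) :
  (forall k, (k < n)%N -> `|c k| <= r) -> forall x y, 0 <= x <= 1 -> 0 <= y <= 1 ->
  `|\sum_(k < n) c k * x ^+ k| <= n%:R * r /\
  `|\sum_(k < n) c k * x ^+ k - \sum_(k < n) c k * y ^+ k| <=
    n%:R ^+ 2 * r * `|x - y|.
Proof.
move=> cr x y x01 y01; split.
  apply: (le_trans (ler_norm_sum _ _ _)); rewrite mulr_natl -[n in leRHS]card_ord -sumr_const.
  apply: ler_sum => k _; rewrite normrM; apply: le_trans (cr k (ltn_ord k)).
  have /andP[x0 x1] := x01.
  by rewrite ler_piMr // ger0_norm ?exprn_ge0 // exprn_ile1.
rewrite -sumrB; apply: (le_trans (ler_norm_sum _ _ _)).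
apply: (@le_trans _ _ (\sum_(k < n) r * (n%:R * `|x - y|))).
  apply: ler_sum => k _; rewrite -mulrBr normrM; apply: ler_pM => //; first exact: cr.
  apply: (le_trans (expr_lipschitz _ x01 y01)).
  by rewrite ler_wpM2r // ler_nat ltnW.
rewrite sumr_const card_ord -mulr_natl le_eqVlt; apply/orP; left; apply/eqP.
by ring.
Qed.

Section law_lower_bound.
Context {R : realType}.

(** Chosen so that the Lipschitz constant [n ^ 2 * r] of [small_coef_lipschitz], with
    [n = (size q).+1] coefficients, is exactly [e]. *)
Definition coef_radius (q : {poly R}) (e : R) := e / (size q).+1%:R ^+ 2.

Definition coef_prob (q : {poly R}) (r : R) (o : option nat) : \bar R :=
  if o is Some k then normal_prob 0 1 `[q`_k - r, q`_k + r]%classic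
  else poisson_prob 1 0 [set size q].

Definition coef_index (q : {poly R}) : {fset option nat} :=
  seq_fset tt (None :: map Some (iota 0 (size q).+1)).

(** The probability that the degree parameter equals [size q] and that coefficients 0 to [size q]
    are close to those of [q]. The last one is compared with 0, which treats [q = 0] like any other
    polynomial. The value depends on [q] and [e] alone, not on the space realising the law. *)
Definition lip_lower (q : {poly R}) (e : R) : \bar R :=
  (\prod_(o <- coef_index q) coef_prob q (coef_radius q e) o)%E.

Lemma coef_radius_gt0 q (e : R) : 0 < e -> 0 < coef_radius q e.
Proof. by move=> e0; rewrite divr_gt0 // exprn_gt0 // ltr0n. Qed.

Lemma lip_lower_gt0 q (e : R) : 0 < e -> (0 < lip_lower q e)%E.
Proof.
move=> e0; rewrite /lip_lower.
apply: (@big_ind _ (fun u : \bar R => 0 < u)%E) => // [u v u0 v0|[k|] _ /=].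
- exact: mule_gt0.
- exact/normal_itv_gt0/coef_radius_gt0.
- exact: poisson1_gt0.
Qed.

End law_lower_bound.

Section law.
Context {R : realType} {d} {T : measurableType d} {P : probability T R}.
Variables (N : {RV P >-> nat}) (a : nat -> {RV P >-> R}).
Hypothesis N_law : forall A, measurable A -> distribution P N A = poisson_prob 1 0 A.
Hypothesis a_law : forall k A, measurable A -> distribution P (a k) A = normal_prob 0 1 A.
Hypothesis Na_indep : indep_degree_coefs N a.

Let events (o : option nat) : set_system T :=
  if o is Some k then g_sigma_algebra_preimage (a k) else g_sigma_algebra_preimage N.

Let events_measurable o A : events o A -> measurable A.
Proof. by case: o => [k|]; exact: preimage_event_measurable. Qed.

Let eventsI o : setI_closed (events o).
Proof. by case: o => [k|]; exact: preimage_eventI. Qed.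

Let eventsT o : events o setT.
Proof. by case: o => [k|]; exact: preimage_eventT. Qed.

Lemma ext_random_poly w x :
  ext (random_poly N a w) x = \sum_(k < (N w).+1) a k w * clamp x ^+ k.
Proof. exact: (@horner_poly R (N w).+1 (fun k => a k w) (clamp x)). Qed.

Lemma random_poly_eval_measurable x :
  measurable_fun setT (fun w => ext (random_poly N a w) x).
Proof.
rewrite (_ : (fun w => _) = (fun w => \sum_(k < (N w).+1) a k w * clamp x ^+ k)); last first.
  by apply/funext => w; exact: ext_random_poly.
apply: (@measurable_nat_index _ _ _ N (fun n w => \sum_(k < n.+1) a k w * clamp x ^+ k)) => // n.
by apply: measurable_sum => k; apply: measurable_funM => //; exact: measurable_cst.
Qed.

(** The value at [x] differs from [y] by [a 0 - Y], with [Y] a function of [N] and the other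
    coefficients. The density bound gives [2 * normal_peak 1] for [a 0], and [small_ball_indep]
    multiplies it by 4. *)
Lemma random_poly_small_ball x y (r : R) : 0 < r ->
  (P (near_value (fun w => ext (random_poly N a w) x) y r) <=
   (8 * normal_peak 1 * r)%:E)%E.
Proof.
move=> r0.
pose G := other_events events (Some 0%N).
pose Y w := y - \sum_(k < N w) a k.+1 w * clamp x ^+ k.+1.
have -> : near_value (fun w => ext (random_poly N a w) x) y r =
    setT `&` near_value (fun w => a 0%N w - Y w) 0 r.
  rewrite setTI /near_value; apply: eq_set => w; rewrite ext_random_poly big_ord_recl.
  by rewrite expr0 mulr1 subr0 /Y opprB addrA.
have sub o : o <> Some 0%N -> events o `<=` G by move=> oS A oA; exists o.
have mN : measurable_fun [set: g_sigma_algebraType G] (N : g_sigma_algebraType G -> nat).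
  by apply: measurable_fun_sub; exact: (sub None).
have ma k : measurable_fun [set: g_sigma_algebraType G] (a k.+1 : g_sigma_algebraType G -> R).
  by apply: measurable_fun_sub; exact: (sub (Some k.+1)).
have mY : measurable_fun [set: g_sigma_algebraType G] (Y : g_sigma_algebraType G -> R).
  apply: measurable_funB; first exact: measurable_cst.
  apply: (@measurable_nat_index _ (g_sigma_algebraType G) _ N
    (fun n w => \sum_(k < n) a k.+1 w * clamp x ^+ k.+1)) => // n.
  by apply: measurable_sum => k; apply: measurable_funM => //; exact: measurable_cst.
have Gm E : <<s G >> E -> measurable E by exact: other_events_measurable.
have peak0 := @normal_peak_ge0 R 1.
have := @small_ball_indep _ _ _ P G (a 0%N) Y (2 * normal_peak 1) _ Gm _ _ mY setT r.
rewrite probability_setT mule1 [4 * _]mulrA -natrM; apply => //.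
- by rewrite mulr_ge0.
- move=> E z r' GE r'0; rewrite setIC (indep_other (l := Some 0%N) _ _ _ _ _ GE) //; last first.
    by rewrite near_valueE; apply: preimage_event.
  apply: lee_wpmul2r => //; rewrite near_valueE.
  have := a_law 0%N (measurable_itv `[z - r', z + r']).
  rewrite /distribution /pushforward => ->; exact: normal_itv_le.
- exact: (@measurableT _ (g_sigma_algebraType G)).
Qed.

Lemma random_poly_lip_set_ge q (e : R) : 0 < e ->
  (lip_lower q e <= P (random_poly N a @^-1` lip_set q e))%E.
Proof.
move=> e0; pose n := size q; pose r := coef_radius q e.
have r0 : 0 < r by exact: coef_radius_gt0.
have n0 : 0 < n.+1%:R ^+ 2 :> R by rewrite exprn_gt0 // ltr0n.
pose E o : set T := if o is Some k then near_value (a k) q`_k r else N @^-1` [set n].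
have EJ o : events o (E o).
  case: o => [k|] /=; last exact: preimage_event.
  by rewrite near_valueE; exact: preimage_event.
have PE o : P (E o) = coef_prob q r o.
  case: o => [k|] /=.
    have := a_law k (measurable_itv `[q`_k - r, q`_k + r]).
    by rewrite near_valueE /distribution /pushforward => ->.
  by have := @N_law [set n] I; rewrite /distribution /pushforward => ->.
have -> : lip_lower q e = P (\bigcap_(o in [set` coef_index q]) E o).
  rewrite (Na_indep (E := E)); last by move=> o _; exact: EJ.
  by apply: eq_bigr => o _; rewrite PE.
apply: le_measure; rewrite ?inE.
- by apply: fin_bigcap_measurable => // o _; exact: events_measurable (EJ o).
- by apply: preimage_lip_set_measurable; exact: random_poly_eval_measurable.
move=> w H.
have inJ o : o \in None :: map Some (iota 0 n.+1) -> [set` coef_index q] o.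
  by move=> ol; rewrite /= seq_fsetE.
have NJ : N w = n by apply/(H None)/inJ.
have aJ k : (k < n.+1)%N -> `|a k w - q`_k| <= r.
  move=> kn; apply/(H (Some k))/inJ.
  by rewrite in_cons; apply/orP; right; apply/mapP; exists k; rewrite ?mem_iota.
have dE x : ext (random_poly N a w) x - q.[clamp x] =
    \sum_(k < n.+1) (a k w - q`_k) * clamp x ^+ k.
  rewrite ext_random_poly NJ (@horner_coef_wide _ n.+1) // -sumrB.
  by apply: eq_bigr => k _; rewrite mulrBl.
have z01 : 0 <= (0 : R) <= 1 by rewrite lexx ler01.
split=> /=.
  have := dE 0; rewrite clamp_id // => ->.
  rewrite big_ord_recl big1 ?addr0 => [|k _]; last by rewrite expr0n mulr0.
  rewrite expr0 mulr1; apply: (le_trans (aJ _ _)) => //.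
  by rewrite ler_pdivrMr // ler_peMr ?(ltW e0) // exprn_ege1 // ler1n.
move=> [u v] _ /=; rewrite !dE.
have [_ /le_trans] := small_coef_lipschitz aJ (clamp01 (ratr u)) (clamp01 (ratr v)).
by apply; rewrite /r /coef_radius mulrCA divff ?mulr1 // gt_eqF.
Qed.

End law.

(** * Transfer of the estimates to the law on C[0, 1] *)

Section is_Ppoly_law.
Context {R : realType} (mu : set (borelC01 R) -> \bar R).
Hypothesis mu_law : is_Ppoly mu.

Lemma is_Ppoly_polys : mu (@polys R) = 1%E.
Proof.
case: mu_law => d [T [P [N [a [_ _ _ muE]]]]].
rewrite muE; last exact: polys_measurable.
rewrite /pushforward (_ : _ @^-1` _ = setT) ?probability_setT //.
by apply/seteqP; split=> // w _; exists (\poly_(k < (N w).+1) a k w).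
Qed.

Lemma is_Ppoly_small_ball x y (r : R) : 0 < r ->
  (mu [set g | `|ext g x - y| <= r]%R <= (8 * normal_peak 1 * r)%:E)%E.
Proof.
move=> r0; case: mu_law => d [T [P [N [a [_ a_law Na muE]]]]].
rewrite muE; last exact: (measurable_near_value y r (@ext_eval_measurable R x)).
exact: (random_poly_small_ball a_law Na).
Qed.

Lemma is_Ppoly_lip_set_ge q (e : R) : 0 < e -> (lip_lower q e <= mu (lip_set q e))%E.
Proof.
move=> e0; case: mu_law => d [T [P [N [a [N_law a_law Na muE]]]]].
rewrite muE; last exact: lip_set_measurable.
exact: (random_poly_lip_set_ge N_law a_law Na).
Qed.

End is_Ppoly_law.

(** * Almost sure properties of the family *)

Section almost_everywhere_tools.
Context {d} {T : measurableType d} {R : realType} (P : probability T R).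

Lemma ae_forall_countType (J : countType) (Q : J -> T -> Prop) :
  (forall j, {ae P, forall w, Q j w}) -> {ae P, forall w, forall j, Q j w}.
Proof.
move=> HQ.
have : {ae P, forall w, forall n, if @choice.unpickle J n is Some j then Q j w else True}.
  apply: (@ae_foralln _ _ _ P (fun n w =>
    if @choice.unpickle J n is Some j then Q j w else True)) => n.
  by case: choice.unpickle => [j|]; [exact: HQ|exact: aeW].
apply: filterS => w Hw j; have := Hw (choice.pickle j).
by rewrite choice.pickleK.
Qed.

Lemma ae_and (Q Q' : T -> Prop) : {ae P, forall w, Q w} -> {ae P, forall w, Q' w} ->
  {ae P, forall w, Q w /\ Q' w}.
Proof. by move=> HQ HQ'; apply: (filterS2 _ _ HQ HQ') => w. Qed.

Lemma ae_of_null (H : set T) (Q : T -> Prop) : measurable H -> P H = 0%E ->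
  (forall w, ~ Q w -> H w) -> {ae P, forall w, Q w}.
Proof. by move=> mH PH QH; exists H; split. Qed.

Lemma small_measure_null (H : set T) (D : R) : measurable H ->
  (forall M : nat, (P H <= (D / M.+1%:R)%:E)%E) -> P H = 0%E.
Proof.
move=> mH HD; have fH := fin_num_measure P H mH.
apply/eqP; rewrite eq_le measure_ge0 andbT -(fineK fH) lee_fin leNgt; apply/negP => p0.
have := HD (Num.truncn (D / fine (P H))); rewrite -(fineK fH) lee_fin.
rewrite ler_pdivlMr ?ltr0n // mulrC -ler_pdivlMr // leNgt.
by rewrite truncnS_gt.
Qed.

(** [M + 2] events of probability [D / (M + 1) ^ 2] have a union of probability at most
    [2 * D / (M + 1)]. An event asking for some real [t] is not visibly measurable; covering it by
    grid events for every [M] places it inside this measurable null set. *)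
Lemma grid_null (B : nat -> nat -> set T) (D : R) : 0 <= D ->
  (forall M j, measurable (B M j)) ->
  (forall M j, (j <= M.+1)%N -> (P (B M j) <= (D / M.+1%:R ^+ 2)%:E)%E) ->
  measurable (\bigcap_M \big[setU/set0]_(j < M.+2) B M j) /\
  P (\bigcap_M \big[setU/set0]_(j < M.+2) B M j) = 0%E.
Proof.
move=> D0 mB PB.
have mU M : measurable (\big[setU/set0]_(j < M.+2) B M j) by apply: bigsetU_measurable.
have mI : measurable (\bigcap_M \big[setU/set0]_(j < M.+2) B M j).
  exact: bigcapT_measurable.
split=> //; apply: (@small_measure_null _ (2 * D)) => // M.
apply: (@le_trans _ _ (P (\big[setU/set0]_(j < M.+2) B M j))).
  by apply: le_measure; rewrite ?inE // => w /(_ M); exact.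
apply: (@le_trans _ _ (\sum_(j < M.+2) P (B M j))%E).
  elim: M.+2 => [|m IH]; first by rewrite !big_ord0 measure0.
  rewrite !big_ord_recr /=; apply: (le_trans (measureU2 _ _ _)) => //.
    by apply: bigsetU_measurable.
  exact: leeD.
apply: (@le_trans _ _ (\sum_(j < M.+2) (D / M.+1%:R ^+ 2)%:E)%E).
  by apply: lee_sum => j _; apply: PB; rewrite -ltnS.
rewrite sumEFin lee_fin sumr_const card_ord -[leLHS]mulr_natl.
have M0 : 0 < M.+1%:R :> R by rewrite ltr0n.
have -> : 2 * D / M.+1%:R = (2 * M.+1%:R) * (D / M.+1%:R ^+ 2).
  by field; rewrite ?nat1r ?natr1 pnatr_eq0.
apply: ler_wpM2r; first by rewrite divr_ge0 // exprn_ge0 // ltW.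
by rewrite -natrM ler_nat mul2n -addnn addSn ltnS addnS ltnS leq_addr.
Qed.

End almost_everywhere_tools.

Lemma grid_point (R : realType) (t : R) M : 0 <= t <= 1 ->
  exists2 j, (j <= M.+1)%N &
    0 <= (j%:R / M.+1%:R : R) <= 1 /\ `|j%:R / M.+1%:R - t| <= M.+1%:R^-1.
Proof.
move=> /andP[t0 t1]; have M0 : 0 < M.+1%:R :> R by rewrite ltr0n.
have tM : 0 <= t * M.+1%:R by rewrite mulr_ge0.
have /andP[j1 j2] := truncn_itv tM; set j := Num.truncn _ in j1 j2.
have jM : (j <= M.+1)%N.
  by rewrite -(ler_nat R); apply: (le_trans j1); rewrite ler_piMl // ltW.
exists j => //; split.
  by rewrite divr_ge0 //= ler_pdivrMr // mul1r ler_nat.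
have -> : j%:R / M.+1%:R - t = (j%:R - t * M.+1%:R) / M.+1%:R.
  by field; rewrite ?nat1r ?natr1 pnatr_eq0.
rewrite normrM normfV (gtr0_norm M0) -[leRHS]mul1r ler_wpM2r ?invr_ge0 ?(ltW M0) //.
by move: j1 j2; rewrite -[j.+1%:R]natr1 ler_norml => ? ?; apply/andP; split; lra.
Qed.

Section random_functions.
Context {R : realType} {d} {T : measurableType d} {P : probability T R}.
Variable f : nat -> {RV P >-> borelC01 R}.
Hypothesis f_indep : indep_RVs f.
Hypothesis f_law : forall i : nat, is_Ppoly (distribution P (f i)).

Let events i : set_system T := g_sigma_algebra_preimage (f i).

Let events_measurable i A : events i A -> measurable A.
Proof. exact: preimage_event_measurable. Qed.

Let eventsI i : setI_closed (events i).
Proof. exact: preimage_eventI. Qed.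

Let eventsT i : events i setT.
Proof. exact: preimage_eventT. Qed.

Let ev i x w : R := ext (f i w) x.
Let C : R := 8 * normal_peak 1.
Let G l := other_events events l.

Let C0 : 0 <= C. Proof. by rewrite mulr_ge0 // normal_peak_ge0. Qed.

Let ev_measurable i x : measurable_fun setT (ev i x).
Proof. exact: (measurableT_comp (@ext_eval_measurable R x)). Qed.

Let ev_other i l x : i != l ->
  measurable_fun [set: g_sigma_algebraType (G l)] (ev i x : g_sigma_algebraType (G l) -> R).
Proof.
move=> il; apply: (measurableT_comp (@ext_eval_measurable R x)).
by apply: measurable_fun_sub => A fA; exists i => //; apply/eqP.
Qed.

Let ev_ball l x E y (r : R) : <<s G l >> E -> 0 < r ->
  (P (E `&` near_value (ev l x) y r) <= (C * r)%:E * P E)%E.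
Proof.
move=> GE r0; rewrite setIC (indep_other (l := l) _ _ _ _ _ GE) //; last first.
  rewrite near_valueE -[ev l x @^-1` _]/(f l @^-1` ((fun g => ext g x) @^-1` `[y - r, y + r])).
  apply: preimage_event; rewrite -[X in measurable X]setTI.
  exact: (@ext_eval_measurable R x).
by apply: lee_wpmul2r => //; exact: (is_Ppoly_small_ball (f_law l)).
Qed.

Let GE_measurable l E : <<s G l >> E -> measurable E.
Proof. exact: other_events_measurable. Qed.

Definition diff_near i j (k : int) x (r : R) : set T :=
  [set w | `|ev i x w - ev j x w - k%:~R| <= r].

Let diff_nearE i j k x r :
  diff_near i j k x r = near_value (fun w => ev i x w - (ev j x w + k%:~R)) 0 r.
Proof. by rewrite /diff_near /near_value; apply: eq_set => w; rewrite subr0 opprD addrA. Qed.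

Lemma diff_near_measurable i j k x r : measurable (diff_near i j k x r).
Proof.
rewrite diff_nearE; apply: measurable_near_value.
by apply: measurable_funB => //; apply: measurable_funD => //; exact: measurable_cst.
Qed.

(** Only the randomness of [f i] is spent: [f j], the integer and [E] all belong to the other
    indices. *)
Lemma diff_near_indep i j k x r E : i != j -> <<s G i >> E -> 0 < r ->
  (P (E `&` diff_near i j k x r) <= (4 * C * r)%:E * P E)%E.
Proof.
move=> ij GE r0; rewrite diff_nearE.
apply: (@small_ball_indep _ _ _ P (G i) (ev i x) (fun w => ev j x w + k%:~R)) => //.
- exact: GE_measurable.
- by move=> ? ? ?; exact: ev_ball.
- by apply: measurable_funD; [apply: ev_other; rewrite eq_sym|exact: measurable_cst].
Qed.

Lemma diff_near_le i j k x r : i != j -> 0 < r ->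
  (P (diff_near i j k x r) <= (4 * C * r)%:E)%E.
Proof.
move=> ij r0; have := @diff_near_indep i j k x r setT ij _ r0.
rewrite setTI probability_setT mule1; apply.
exact: (@measurableT _ (g_sigma_algebraType (G i))).
Qed.

(** The first event does not involve [f l], so it can be the [E] of [diff_near_indep] applied to
    [f l]. Since [m] may equal [i] or [j], pairs with a common function are included. *)
Lemma diff_near2_le i j l m k k' x r : i != j -> l != m -> i != l -> j != l -> 0 < r ->
  (P (diff_near i j k x r `&` diff_near l m k' x r) <= ((4 * C * r) ^+ 2)%:E)%E.
Proof.
move=> ij lm il jl r0; apply: (le_trans (diff_near_indep _ _ _ _ r0)) => //.
  have : measurable (diff_near i j k x r : set (g_sigma_algebraType (G l))); last exact.
  rewrite diff_nearE.
  apply: (@measurable_near_value _ (g_sigma_algebraType (G l))).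
  apply: measurable_funB; first exact: ev_other.
  by apply: measurable_funD; [exact: ev_other|exact: measurable_cst].
rewrite expr2 [leRHS]EFinM; apply: lee_wpmul2l; last exact: diff_near_le.
by rewrite lee_fin; apply: mulr_ge0; [exact: mulr_ge0|exact: ltW].
Qed.

Lemma ae_polys : {ae P, forall w, forall i, polys (f i w)}.
Proof.
apply: ae_foralln => i.
have mp : measurable (f i @^-1` (@polys R)).
  by rewrite -[X in measurable X]setTI; apply: measurable_funPT => //; exact: polys_measurable.
apply: (@ae_of_null _ _ _ _ (~` (f i @^-1` (@polys R)))) => //; first exact: measurableC.
by rewrite probability_setC // [P _](is_Ppoly_polys (f_law i)) subee.
Qed.

(** Needed at the two end points; at 0 it also prevents a difference from being a constant integer,
    on which the finiteness of crossing sets rests. *)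
Lemma ae_diff_nonint x : {ae P, forall w, forall p : nat * nat * int,
  p.1.1 != p.1.2 -> ev p.1.1 x w - ev p.1.2 x w <> p.2%:~R}.
Proof.
apply: ae_forall_countType => -[[i j] k] /=.
have [ij|ij] := boolP (i != j); last exact: aeW.
pose H := \bigcap_M diff_near i j k x M.+1%:R^-1.
have mH : measurable H by apply: bigcapT_measurable => M; exact: diff_near_measurable.
apply: (@ae_of_null _ _ _ _ H) => //.
  apply: (@small_measure_null _ _ _ _ _ (4 * C)) => // M.
  apply: le_trans (diff_near_le k x ij _); last by rewrite invr_gt0 ltr0n.
  by apply: le_measure; rewrite ?inE //; [exact: diff_near_measurable|move=> w /(_ M); exact].
move=> w /not_implyP[_ /contrapT E] M _; rewrite /diff_near /= E subrr normr0.
by rewrite invr_ge0.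
Qed.

(** The bound is what a double root at [t] gives, with [K.+1] bounding the cofactor; taking [K] in
    nat makes the parameters countable. *)
Lemma ae_no_double_crossing : {ae P, forall w, forall p : nat * nat * int * nat,
  let: (i, j, k, K) := p in i != j -> ~ exists2 t, 0 <= t <= 1 &
    forall x, 0 <= x <= 1 -> `|ev i x w - ev j x w - k%:~R| <= K.+1%:R * (x - t) ^+ 2}.
Proof.
apply: ae_forall_countType => -[[[i j] k] K].
have [ij|ij] := boolP (i != j); last exact: aeW.
pose B M m := diff_near i j k (m%:R / M.+1%:R) (K.+1%:R / M.+1%:R ^+ 2).
have [|||mH H0] := @grid_null _ _ _ P B (4 * C * K.+1%:R).
- by apply: mulr_ge0 => //; exact: mulr_ge0.
- by move=> M m; exact: diff_near_measurable.
- move=> M m _; apply: (le_trans (diff_near_le _ _ ij _)).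
    by rewrite divr_gt0 ?exprn_gt0 ?ltr0n.
  by rewrite mulrA.
apply: (ae_of_null mH H0) => w /not_implyP[_ /contrapT[t t01 Ht]] M _.
have [m mM [g01 gt]] := grid_point M t01.
rewrite -bigcup_mkord; exists m => //=; rewrite /B /diff_near /=.
apply: (le_trans (Ht _ g01)); rewrite ler_pM2l ?ltr0n // -exprVn.
by rewrite -(real_normK (num_real _)); apply: lerXn2r => //; rewrite nnegrE.
Qed.

(** Simple roots give only linear bounds, but two of them: on a grid of step [1 / (M + 1)] the
    product of two probabilities restores the order [1 / M ^ 2] required by [grid_null]. *)
Lemma ae_no_common_crossing : {ae P, forall w, forall p : nat * nat * nat * nat * int * int * nat,
  let: (i, j, l, m, k, k', K) := p in i != j -> l != m -> i != l -> j != l ->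
  ~ exists2 t, 0 <= t <= 1 & forall x, 0 <= x <= 1 ->
    `|ev i x w - ev j x w - k%:~R| <= K.+1%:R * `|x - t| /\
    `|ev l x w - ev m x w - k'%:~R| <= K.+1%:R * `|x - t|}.
Proof.
apply: ae_forall_countType => -[[[[[[i j] l] m] k] k'] K].
have [ij|ij] := boolP (i != j); last exact: aeW.
have [lm|lm] := boolP (l != m); last exact: aeW.
have [il|il] := boolP (i != l); last exact: aeW.
have [jl|jl] := boolP (j != l); last exact: aeW.
pose B M n := diff_near i j k (n%:R / M.+1%:R) (K.+1%:R / M.+1%:R) `&`
              diff_near l m k' (n%:R / M.+1%:R) (K.+1%:R / M.+1%:R).
have [|||mH H0] := @grid_null _ _ _ P B ((4 * C * K.+1%:R) ^+ 2).
- by rewrite sqr_ge0.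
- by move=> M n; apply: measurableI; exact: diff_near_measurable.
- move=> M n _; apply: (le_trans (diff_near2_le _ _ _ ij lm il jl _)).
    by rewrite divr_gt0 ?ltr0n.
  by rewrite mulrA expr_div_n.
apply: (ae_of_null mH H0) => w nQ M _.
have [t t01 Ht] : exists2 t, 0 <= t <= 1 & forall x, 0 <= x <= 1 ->
    `|ev i x w - ev j x w - k%:~R| <= K.+1%:R * `|x - t| /\
    `|ev l x w - ev m x w - k'%:~R| <= K.+1%:R * `|x - t|.
  by apply: contrapT => nt; apply: nQ.
have [n nM [g01 gt]] := grid_point M t01.
rewrite -bigcup_mkord; exists n => //=; rewrite /B /diff_near.
have [h1 h2] := Ht _ g01.
by split=> /=; [apply: (le_trans h1)|apply: (le_trans h2)]; rewrite ler_pM2l ?ltr0n.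
Qed.

(** With [c] the common lower bound, the first [m] functions all miss the target with probability at
    most [(1 - c) ^ m], which tends to 0. Rational polynomials and radii [1 / (n + 1)] leave
    countably many targets. *)
Lemma ae_lip_dense : {ae P, forall w, forall p : {poly rat} * nat,
  exists i, lip_set (map_poly ratr p.1) p.2.+1%:R^-1 (f i w)}.
Proof.
apply: ae_forall_countType => -[q0 n] /=.
set q := map_poly ratr q0; set e : R := n.+1%:R^-1.
have e0 : 0 < e by rewrite invr_gt0 ltr0n.
pose A := lip_set q e; have mA : measurable A by exact: lip_set_measurable.
have mfA i : measurable (f i @^-1` A).
  by rewrite -[X in measurable X]setTI; exact: measurable_funPT.
have cA i : (lip_lower q e <= P (f i @^-1` A))%E by apply: (is_Ppoly_lip_set_ge (f_law i) q e0).
have c0 := lip_lower_gt0 q e0.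
have fc : lip_lower q e \is a fin_num.
  rewrite ge0_fin_numE; last exact: ltW.
  by apply: (le_lt_trans (cA 0%N)); rewrite ltey_eq fin_num_measure.
set c := fine (lip_lower q e).
have cE : lip_lower q e = c%:E by rewrite /c fineK.
have {}c0 : 0 < c by rewrite -lte_fin -cE.
have c1 : c <= 1 by rewrite -lee_fin -cE; apply: (le_trans (cA 0%N)); exact: probability_le1.
pose H := \bigcap_i ~` (f i @^-1` A).
have mH : measurable H by apply: bigcapT_measurable => i; exact: measurableC.
have Hm m : (P H <= ((1 - c) ^+ m)%:E)%E.
  pose J : {fset nat} := seq_fset tt (iota 0 m).
  apply: (@le_trans _ _ (P (\bigcap_(i in [set` J]) ~` (f i @^-1` A)))).
    apply: le_measure; rewrite ?inE //.
      by apply: fin_bigcap_measurable => // i _; exact: measurableC.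
    by move=> w Hw i _; exact: Hw.
  rewrite (f_indep (E := fun i => ~` (f i @^-1` A))); last first.
    by move=> i _; exists (~` A); [exact: measurableC|rewrite setTI].
  have -> : m = size (enum_fset J).
    by rewrite size_seq_fset undup_id ?iota_uniq ?size_iota.
  elim: (enum_fset J) => [|i s IH]; first by rewrite big_nil expr0.
  rewrite big_cons /= exprS EFinM; apply: lee_pmul => //.
    by apply: (@big_ind _ (fun u : \bar R => 0 <= u)%E) => // u v; exact: mule_ge0.
  rewrite probability_setC // EFinB; apply: leeB => //.
  by rewrite -cE.
apply: (@ae_of_null _ _ _ _ H) => //; last first.
  by move=> w nw i _ wA; apply: nw; exists i.
have fH := fin_num_measure P H mH.
apply/eqP; rewrite eq_le measure_ge0 andbT -(fineK fH) lee_fin leNgt; apply/negP => p0.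
have c1' : `|1 - c| < 1 by rewrite ger0_norm; lra.
have /cvgrPdist_lt /(_ _ p0) [m _ Hmm] := cvg_expr c1'.
have := Hmm m (leqnn _); rewrite /= sub0r normrN ger0_norm ?exprn_ge0 ?subr_ge0 // ltNge.
by rewrite -lee_fin fineK // Hm.
Qed.

End random_functions.

(** * Deterministic facts on polynomials and transversality *)

Section generic_polynomials.
Variable R : realType.
Implicit Types (p q : {poly R}) (x t : R).

Lemma poly_bound01 p : exists K : nat, forall x, 0 <= x <= 1 -> `|p.[x]| <= K.+1%:R.
Proof.
have [u Hu] := poly_itv_bound p 0 1; exists (Num.truncn u) => x /Hu pu.
by apply: (le_trans pu); apply: ltW; exact: truncnS_gt.
Qed.

(** On [0, 1] only the integers between [- K.+1] and [K.+1] can be values of [p], so crossings are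
    roots of the product [Q] of the corresponding translates. The value at 0 keeps every factor
    nonzero. *)
Lemma poly_crossing_finite p : ~ isint p.[0] ->
  finite_set [set x | 0 < x < 1 /\ isint p.[x]].
Proof.
move=> p0; have [K HK] := poly_bound01 p.
pose Q := \prod_(i < (K.+1 + K.+1).+1) (p - (i%:Z - K.+1%:Z)%:~R%:P).
have Qn0 : Q != 0.
  apply/prodf_neq0 => i _; apply/eqP => E; apply: p0; exists (i%:Z - K.+1%:Z).
  by have /(congr1 (horner^~ 0)) := E; rewrite hornerD hornerN hornerC horner0 => /eqP; rewrite subr_eq0 => /eqP.
apply: (@sub_finite_set _ _ [set` roots Q 0 1]); last exact: finite_seq.
move=> x [/andP[x0 x1] [k kE]] /=.
rewrite in_roots Qn0 andbT in_itv /= x0 x1 /= andbT.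
have : `|k| <= K.+1%:Z.
  rewrite -(ler_int R) -pmulrn intr_norm -kE; apply: HK.
  by rewrite !ltW.
rewrite ler_norml => /andP[k1 k2].
have ik : (`|(k + K.+1%:Z)%R| < (K.+1 + K.+1).+1)%N.
  rewrite ltnS -lez_nat gez0_abs; last by rewrite -lerBlDr sub0r.
  by rewrite PoszD lerD2r.
rewrite rootE horner_prod (bigD1 (Ordinal ik)) //= hornerD hornerN hornerC.
by rewrite gez0_abs -?lerBlDr ?sub0r // addrK kE subrr mul0r.
Qed.

(** Fermat's rule in factored form: if the cofactor of ['X - t%:P] did not vanish at [t], it would
    keep its sign nearby and [p - p.[t]] would change sign at [t]. *)
Lemma poly_extremum_square p t : 0 < t < 1 ->
  local_extremum (fun u => polyC01 p u) (clampI t) ->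
  exists r, p - p.[t]%:P = ('X - t%:P) ^+ 2 * r.
Proof.
move=> /andP[t0 t1] ext_t; have t01 : 0 <= t <= 1 by rewrite !ltW.
have [|r rE] := @root_dvdXsubC R (p - p.[t]%:P) t; first by rewrite !hornerE subrr.
have pE x : p.[x] - p.[t] = (x - t) * r.[x].
  by have /(congr1 (horner^~ x)) := rE; rewrite hornerM hornerXsubC hornerD hornerN hornerC.
suff /root_dvdXsubC[r' r'E] : r.[t] = 0 by exists r'; rewrite rE r'E expr2 mulrA.
apply/eqP/negP => /negP rt0; have rt : 0 < `|r.[t]| by rewrite normr_gt0.
have [e1 e10 He1] := continuous_dist t (@continuous_horner R r) rt.
have local_le (Q : I01 R -> Prop) : (\forall u \near clampI t, Q u) ->
    exists2 e : R, 0 < e & forall x, `|x - t| < e -> Q (clampI x).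
  move=> /(@clampI_continuous R t) /nbhs_ballP[e /= e0 He]; exists e => // x xt.
  by apply: He; rewrite /ball /= distrC.
have contra (e : R) : 0 < e -> ~ (forall x, 0 <= x <= 1 -> `|x - t| < e -> p.[x] <= p.[t]) /\
    ~ (forall x, 0 <= x <= 1 -> `|x - t| < e -> p.[t] <= p.[x]).
  (* Small enough for [t - s] and [t + s] to lie in [0, 1], within [e] of [t], and where the
     cofactor still has the sign of [r.[t]]. *)
  move=> e0; pose s := Num.min (Num.min (e / 2) (e1 / 2)) (Num.min t (1 - t)).
  have s0 : 0 < s by rewrite !lt_min !divr_gt0 // t0 subr_gt0.
  have : s <= s by []. rewrite {2}/s !le_min => /andP[/andP[se se1] /andP[st s1t]].
  have a1 : `|t + s - t| = s by rewrite addrAC subrr add0r gtr0_norm.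
  have a2 : `|t - s - t| = s by rewrite addrAC subrr add0r normrN gtr0_norm.
  have := He1 (t + s); have := He1 (t - s); rewrite a1 a2 !ltr_norml.
  move=> /(_ ltac:(lra)) r2 /(_ ltac:(lra)) r1.
  have := pE (t + s); have := pE (t - s).
  have -> : t - s - t = - s by ring.
  have -> : t + s - t = s by ring.
  have i1 : 0 <= t + s <= 1 by apply/andP; split; lra.
  have i2 : 0 <= t - s <= 1 by apply/andP; split; lra.
  move=> p2 p1; move: r1 r2; case: (ltrgtP 0 r.[t]) rt0 => [rp|rn|<-] rt0; rewrite ?eqxx // in rt0 *.
    rewrite gtr0_norm // => /andP[r1 _] /andP[r2 _].
    have h1 : 0 < s * r.[t + s] by rewrite mulr_gt0 //; lra.
    have h2 : 0 < s * r.[t - s] by rewrite mulr_gt0 //; lra.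
    split=> H.
      by have := H _ i1; rewrite a1 => /(_ ltac:(lra)); lra.
    by have := H _ i2; rewrite a2 => /(_ ltac:(lra)); lra.
  rewrite ltr0_norm // => /andP[_ r1] /andP[_ r2].
  have h1 : s * r.[t + s] < 0 by rewrite pmulr_rlt0 //; lra.
  have h2 : s * r.[t - s] < 0 by rewrite pmulr_rlt0 //; lra.
  split=> H.
    by have := H _ i2; rewrite a2 => /(_ ltac:(lra)); lra.
  by have := H _ i1; rewrite a1 => /(_ ltac:(lra)); lra.
have pc x : 0 <= x <= 1 -> polyC01 p (clampI x) = p.[x] by exact: ext_poly.
case: ext_t => /local_le[e e0 He].
  by apply: (contra e e0).1 => x x01 xt; rewrite -!pc //; exact: He.
by apply: (contra e e0).2 => x x01 xt; rewrite -!pc //; exact: He.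
Qed.

(** Half of [e] pays for rounding the coefficients, so that a countable set of targets suffices. *)
Lemma rat_poly_close q (e : R) : 0 < e -> exists q0 : {poly rat},
  forall g : C01 R, lip_close g (map_poly ratr q0) (e / 2) -> lip_close g q e.
Proof.
move=> e0; pose n := size q.
have n0 : 0 < n.+1%:R :> R by rewrite ltr0n.
pose r := e / 2 / n.+1%:R ^+ 2.
have r0 : 0 < r by rewrite !divr_gt0 // exprn_gt0.
have /choice[c Hc] k : exists c : rat, `|ratr c - q`_k| <= r.
  have [c] : exists c, ratr c \in `]q`_k - r, q`_k + r[ by apply: rat_in_itvoo; lra.
  rewrite in_itv /= => /andP[? ?]; exists c; rewrite ler_norml; apply/andP; split; lra.
exists (\poly_(k < n.+1) c k) => g.
set q' := map_poly _ _.
have dE x : q'.[x] - q.[x] = \sum_(k < n.+1) (ratr (c k) - q`_k) * x ^+ k.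
  rewrite (@horner_coef_wide _ n.+1 q') ?(@horner_coef_wide _ n.+1 q) //; last first.
    by rewrite size_map_poly size_poly.
  rewrite -sumrB; apply: eq_bigr => k _; rewrite coef_map coef_poly ltn_ord mulrBl //.
have cl := small_coef_lipschitz (fun k (_ : (k < n.+1)%N) => Hc k).
have n2r : n.+1%:R ^+ 2 * r = e / 2 by rewrite /r mulrC divfK // gt_eqF // exprn_gt0.
have nr : n.+1%:R * r <= e / 2.
  by rewrite -n2r ler_wpM2r ?(ltW r0) // expr2 ler_peMl ?(ltW n0) // ler1n.
move=> [g1 g2]; split=> [x x01|x y x01 y01].
  have := g1 _ x01; have [+ _] := cl _ _ x01 x01; rewrite -dE => h1 h2.
  have := ler_normD (ext g x - q'.[x]) (q'.[x] - q.[x]); rewrite addrA subrK; lra.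
have := g2 _ _ x01 y01; have [_ +] := cl _ _ x01 y01; rewrite -!dE n2r => h1 h2.
have -> : ext g x - q.[x] - (ext g y - q.[y]) =
   (ext g x - q'.[x] - (ext g y - q'.[y])) + (q'.[x] - q.[x] - (q'.[y] - q.[y])) by ring.
by apply: (le_trans (ler_normD _ _)); lra.
Qed.

End generic_polynomials.

(** The definition speaks of functions, the hypotheses of indices; distinct functions have distinct
    indices. A common crossing is turned into linear bounds by dividing out the roots, with the
    larger of the two cofactor bounds as [K]. *)
Lemma transverse_family (R : realType) (F : nat -> C01 R) :
  (forall i, exists p, F i = polyC01 p) ->
  (forall i j (k : int), i != j -> ext (F i) 0 - ext (F j) 0 <> k%:~R) ->
  (forall i j (k : int), i != j -> ext (F i) 1 - ext (F j) 1 <> k%:~R) ->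
  (forall i j (k : int) K, i != j -> ~ exists2 t : R, 0 <= t <= 1 & forall x, 0 <= x <= 1 ->
     `|ext (F i) x - ext (F j) x - k%:~R| <= K.+1%:R * (x - t) ^+ 2) ->
  (forall i j l m (k k' : int) K, i != j -> l != m -> i != l -> j != l ->
     ~ exists2 t : R, 0 <= t <= 1 & forall x, 0 <= x <= 1 ->
       `|ext (F i) x - ext (F j) x - k%:~R| <= K.+1%:R * `|x - t| /\
       `|ext (F l) x - ext (F m) x - k'%:~R| <= K.+1%:R * `|x - t|) ->
  transverse [set F i | i in [set: nat]].
Proof.
move=> /choice[p pE] F0 F1 Fsq Fcommon.
have extF i x : 0 <= x <= 1 -> ext (F i) x = (p i).[x].
  by move=> x01; rewrite pE ext_poly.
have z01 : 0 <= (0 : R) <= 1 by rewrite lexx ler01.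
have o01 : 0 <= (1 : R) <= 1 by rewrite ler01 lexx.
have neq i j : F i <> F j -> i != j by move=> E; apply/eqP => ij; apply: E; rewrite ij.
have lin i j t (k : int) : 0 <= t <= 1 -> ext (F i) t - ext (F j) t = k%:~R ->
    exists K : nat, forall K' x, (K <= K')%N -> 0 <= x <= 1 ->
      `|ext (F i) x - ext (F j) x - k%:~R| <= K'.+1%:R * `|x - t|.
  move=> t01; rewrite !extF // => tk.
  have [|r rE] := @root_dvdXsubC R (p i - p j - k%:~R%:P) t.
    by rewrite !(hornerD, hornerN) hornerC tk subrr.
  have [K HK] := poly_bound01 r; exists K => K' x KK' x01; rewrite !extF //.
  have /(congr1 (horner^~ x)) := rE; rewrite hornerM hornerXsubC !(hornerD, hornerN) hornerC => ->.
  rewrite normrM mulrC ler_wpM2r //; apply: (le_trans (HK _ x01)).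
  by rewrite ler_nat.
have common i j l m (t : R) : i != j -> l != m -> i != l -> j != l ->
    cr (F i) (F j) t -> cr (F l) (F m) t -> False.
  move=> ij lm il jl /crE[t01 [k kE]] /crE[_ [k' k'E]].
  have [K HK] := lin _ _ _ _ t01 kE; have [K' HK'] := lin _ _ _ _ t01 k'E.
  apply: (Fcommon i j l m k k' (maxn K K') ij lm il jl); exists t => // x x01.
  by split; [apply: HK|apply: HK'] => //; rewrite ?leq_maxl ?leq_maxr.
have crC g h t : cr g h t -> cr h g t.
  by move=> [u /= guh <-]; exists u => //=; rewrite guh.
split.
  move=> _ _ _ _ [i _ <-] [j _ <-] [l _ <-] [m _ <-] /[dup] Fij /neq ij /[dup] Flm /neq lm nset.
  apply/seteqP; split=> // t [cij clm]; exfalso.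
  (* Either [F l] or [F m] is outside {F i, F j} and can serve as the free function, after
     exchanging [l] and [m] if needed, or the two pairs coincide. *)
  have [Fl|nFl] := pselect ([set F i; F j] (F l)); last first.
    apply: (common i j l m t) => //; first by apply: neq => E; apply: nFl; left.
    by apply: neq => E; apply: nFl; right.
  have [Fm|nFm] := pselect ([set F i; F j] (F m)); last first.
    apply: (common i j m l t) => //; [by rewrite eq_sym| | |exact: crC].
      by apply: neq => E; apply: nFm; left.
    by apply: neq => E; apply: nFm; right.
  apply: nset; case: Fl => [/= El|/= El]; case: Fm => [/= Em|/= Em].
  - by exfalso; apply: Flm; rewrite El Em.
  - by rewrite El Em.
  - by rewrite El Em setUC.
  - by exfalso; apply: Flm; rewrite El Em.
move=> _ _ [i _ <-] [j _ <-] /neq ij.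
have n0 : ~ cr (F i) (F j) 0 by move=> /crE[_ [k kE]]; exact: (F0 i j k).
have n1 : ~ cr (F i) (F j) 1 by move=> /crE[_ [k kE]]; exact: (F1 i j k).
have in01 t : cr (F i) (F j) t -> 0 < t < 1.
  move=> ct; have /crE[/andP[t0 t1] _] := ct.
  rewrite !lt_neqAle t0 t1 !andbT; apply/andP; split; apply/eqP => E.
    by apply: n0; rewrite E.
  by apply: n1; rewrite -E.
split=> //.
  apply: (@sub_finite_set _ _ [set x | 0 < x < 1 /\ isint (p i - p j).[x]]).
    move=> t ct; split; first exact: in01.
    by have /crE[t01 [k kE]] := ct; exists k; rewrite hornerD hornerN -!extF.
  apply: poly_crossing_finite => -[k]; rewrite hornerD hornerN -!extF //.
  exact: F0.
move=> t ct; rewrite -[t in local_extremum _ t]clampIK.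
have -> : (fun u => F i u - F j u) = (fun u => polyC01 (p i - p j) u).
  by apply/funext => u; rewrite !pE /= /polyfun hornerD hornerN.
move=> /(poly_extremum_square (in01 _ ct))[r rE].
have /crE[t01 [k kE]] := ct; have [K HK] := poly_bound01 r.
apply: (Fsq i j k K ij); exists (set_val t) => // x x01.
have -> : ext (F i) x - ext (F j) x - k%:~R = (x - set_val t) ^+ 2 * r.[x].
  have /(congr1 (horner^~ x)) := rE.
  rewrite [RHS]hornerM horner_exp hornerXsubC !(hornerD, hornerN) hornerC => <-.
  by rewrite -kE !extF.
by rewrite normrM ger0_norm ?sqr_ge0 // mulrC ler_wpM2r ?sqr_ge0 // HK.
Qed.

Theorem theorem8 (R : realType) (d : measure_display) (T : measurableType d)
    (P : probability T R) (f : nat -> {RV P >-> borelC01 R})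
    (f_indep : indep_RVs f)
    (f_law : forall i : nat, is_Ppoly (distribution P (f i))) :
  {ae P, forall w, @smoothly_dense R [set f i w | i in [set: nat]]}.
Proof.
have H1 := ae_polys f_law.
have H2 := ae_diff_nonint f_indep f_law 0.
have H3 := ae_diff_nonint f_indep f_law 1.
have H4 := ae_no_double_crossing f_indep f_law.
have H5 := ae_no_common_crossing f_indep f_law.
have H6 := ae_lip_dense f_indep f_law.
have := ae_and H1 (ae_and H2 (ae_and H3 (ae_and H4 (ae_and H5 H6)))).
apply: filterS => w [{}H1 [{}H2 [{}H3 [{}H4 [{}H5 {}H6]]]]].
apply: smoothly_dense_criterion.
- exact: card_image_le.
- by move=> _ [i _ <-]; have [p _ <-] := H1 i; exists p.
- move=> q e e0; have [q0 Hq0] := rat_poly_close q e0.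
  (* Gives [1 / (n + 1) <= e / 4], which [lip_set_close] doubles to the [e / 2] required by
     [rat_poly_close]. *)
  pose n := Num.truncn (4 / e).
  have [i Hi] := H6 (q0, n); exists (f i w); first by exists i.
  have n0 : 0 < n.+1%:R :> R by rewrite ltr0n.
  have ne : n.+1%:R^-1 <= e / 4.
    rewrite -[leRHS]invrK lef_pV2 ?posrE ?invr_gt0 ?divr_gt0 // invf_div.
    by apply: ltW; exact: truncnS_gt.
  have [|c1 c2] := lip_set_close _ Hi; first by rewrite invr_ge0 ltW.
  have {}ne : 2 * n.+1%:R^-1 <= e / 2 by move: (n.+1%:R^-1) ne => v; lra.
  apply: Hq0; split=> [x x01|x y x01 y01]; first exact: le_trans (c1 _ x01) ne.
  by apply: (le_trans (c2 _ _ x01 y01)); exact: ler_wpM2r.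
- apply: transverse_family.
  + by move=> i; have [p _ <-] := H1 i; exists p.
  + by move=> i j k; exact: (H2 (i, j, k)).
  + by move=> i j k; exact: (H3 (i, j, k)).
  + by move=> i j k K; exact: (H4 (i, j, k, K)).
  + by move=> i j l m k k' K; exact: (H5 (i, j, l, m, k, k', K)).
Qed.
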